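(* Let $X$ be a finite space. The following conditions are equivalent: (1) $X$ is affine. (2) $X$ is acyclic and quasi-affine. (3) $X$ is quasi-affine and Serre-affine.
   Context: All rings are commutative with unit. A ringed finite space is a ringed space $(X,\mathcal O)$ with $X$ a finite topological space. For $p\in X$, $U_p$ is the smallest open subset containing $p$; $p\le q$ means $q\in U_p$. The stalk is $\mathcal O_p=\mathcal O(U_p)$, with restriction morphisms $\mathcal O_p\to\mathcal O_q$ for $p\le q$. A finite space is a ringed finite space all of whose restriction morphisms are flat. An $\mathcal O$-module is quasi-coherent if it is locally a cokernel of a morphism between free modules of arbitrary rank. Let $A=\Gamma(X,\mathcal O)$ and let $\pi\colon X\to( *,A)$ be the natural morphism to the one-point ringed space with ring $A$. An $\mathcal O$-module $\mathcal M$ is acyclic if $H^i(X,\mathcal M)=0$ for all $i>0$; $X$ is acyclic if $\mathcal O$ is acyclic. $\mathcal M$ is generated by its global sections if the natural map $\pi^*\pi_*\mathcal M\to\mathcal M$ is surjective, i.e. $\Gamma(X,\mathcal M)\otimes_A\mathcal O_x\to\mathcal M_x$ is surjective for every $x\in X$. $X$ is affine if it is acyclic and $\pi^*$ (equivalently $\pi_*=\Gamma(X,-)$) gives an equivalence between the category of $A$-modules and the category of quasi-coherent $\mathcal O$-modules. $X$ is quasi-affine if every quasi-coherent $\mathcal O$-module is generated by its global sections. $X$ is Serre-affine if every quasi-coherent $\mathcal O$-module is acyclic. *)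

(* Defs.v *)
From HB Require Import structures.
From mathcomp Require Import all_boot all_order all_algebra.
From mathcomp Require Import generic_quotient all_classical topology.

Set Implicit Arguments.
Unset Strict Implicit.
Unset Printing Implicit Defensive.

Import GRing.Theory.
Local Open Scope classical_set_scope.
Local Open Scope quotient_scope.
Local Open Scope ring_scope.


(* A list [:: (m1, n1); ...; (mk, nk)] stands for the formal sum
   m1 (x) n1 + ... + mk (x) nk.  The relation below is the congruence on formal
   sums generated by commutativity and the bilinearity relations. *)
Inductive tensor_rel (R : comPzRingType) (M N : lmodType R) :
    seq (M * N) -> seq (M * N) -> Prop :=
| TensorRefl s : tensor_rel s s
| TensorSym s t : tensor_rel s t -> tensor_rel t s
| TensorTrans s t u : tensor_rel s t -> tensor_rel t u -> tensor_rel s u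
| TensorCat s s' t t' :
    tensor_rel s s' -> tensor_rel t t' -> tensor_rel (s ++ t) (s' ++ t')
| TensorComm s t : tensor_rel (s ++ t) (t ++ s)
| TensorDl m m' n : tensor_rel [:: (m + m', n)] [:: (m, n); (m', n)]
| TensorDr m n n' : tensor_rel [:: (m, n + n')] [:: (m, n); (m, n')]
| TensorZ a m n : tensor_rel [:: (a *: m, n)] [:: (m, a *: n)]
| Tensor0 n : tensor_rel [:: (0, n)] [::].

Section Tensor.
Variables (R : comPzRingType) (M N : lmodType R).

Definition tensor_relb (s t : seq (M * N)) : bool := `[< tensor_rel s t >].

Lemma tensor_relb_equiv : equiv_class_of tensor_relb.
Proof.
split=> [s|s t|t s u].
- exact/asboolP/TensorRefl.
- by apply/asboolP/asboolP; exact: TensorSym.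
- by move=> /asboolP st /asboolP tu; exact/asboolP/(TensorTrans st tu).
Qed.

Canonical tensor_equiv := EquivRelPack tensor_relb_equiv.

Definition tensor : Type := {eq_quot tensor_relb}.
HB.instance Definition _ := Choice.on tensor.

Definition tensor_class (s : seq (M * N)) : tensor :=
  \pi_({eq_quot tensor_relb}) s.
Definition tensor_repr (t : tensor) : seq (M * N) :=
  repr (t : {eq_quot tensor_relb}).

Definition pure_tensor (m : M) (n : N) : tensor := tensor_class [:: (m, n)].

Lemma tensor_classP s t : tensor_class s = tensor_class t <-> tensor_rel s t.
Proof.
split=> [/eqP|st]; first by rewrite eqmodE => /asboolP.
by apply/eqP; rewrite eqmodE; exact/asboolP.
Qed.

Lemma tensor_reprK t : tensor_class (tensor_repr t) = t.
Proof. exact: reprK. Qed.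

Lemma tensor_repr_rel s : tensor_rel (tensor_repr (tensor_class s)) s.
Proof. by apply/tensor_classP; rewrite tensor_reprK. Qed.

Definition scale_seq (a : R) (s : seq (M * N)) : seq (M * N) :=
  [seq (a *: x.1, x.2) | x <- s].

Lemma scale_seq_rel a s t :
  tensor_rel s t -> tensor_rel (scale_seq a s) (scale_seq a t).
Proof.
elim=> {s t} [s|s t _|s t u _ + _|s s' t t' _ + _|s t|m m' n|m n n'|b m n|n].
- exact: TensorRefl.
- exact: TensorSym.
- exact: TensorTrans.
- by rewrite /scale_seq !map_cat; exact: TensorCat.
- by rewrite /scale_seq !map_cat; exact: TensorComm.
- by rewrite /= scalerDr; exact: TensorDl.
- exact: TensorDr.
- by rewrite /= scalerA mulrC -scalerA; exact: TensorZ.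
- by rewrite /= scaler0; exact: Tensor0.
Qed.

Definition tensor_add (x y : tensor) : tensor :=
  tensor_class (tensor_repr x ++ tensor_repr y).
Definition tensor_zero : tensor := tensor_class [::].
Definition tensor_scale (a : R) (x : tensor) : tensor :=
  tensor_class (scale_seq a (tensor_repr x)).
Definition tensor_opp (x : tensor) : tensor := tensor_scale (- 1) x.

Lemma tensor_add_class s t :
  tensor_add (tensor_class s) (tensor_class t) = tensor_class (s ++ t).
Proof. by apply/tensor_classP/TensorCat; exact: tensor_repr_rel. Qed.

Lemma tensor_scale_class a s :
  tensor_scale a (tensor_class s) = tensor_class (scale_seq a s).
Proof. by apply/tensor_classP/scale_seq_rel/tensor_repr_rel. Qed.

Lemma tensor_addA : associative tensor_add.
Proof.
move=> x y z; rewrite -(tensor_reprK x) -(tensor_reprK y) -(tensor_reprK z).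
by rewrite !tensor_add_class catA.
Qed.

Lemma tensor_addC : commutative tensor_add.
Proof. by move=> x y; apply/tensor_classP/TensorComm. Qed.

Lemma tensor_add0 : left_id tensor_zero tensor_add.
Proof. by move=> x; rewrite -{1}(tensor_reprK x) tensor_add_class tensor_reprK. Qed.

Lemma tensor_scale0 x : tensor_scale 0 x = tensor_zero.
Proof.
apply/tensor_classP; elim: (tensor_repr x) => [|[m n] s IHs] /=.
  exact: TensorRefl.
apply: (@TensorCat _ _ _ [:: (0 *: m, n)] [::] (scale_seq 0 s) [::]) => //.
by rewrite scale0r; exact: Tensor0.
Qed.

Lemma tensor_scaleDl x a b :
  tensor_scale (a + b) x = tensor_add (tensor_scale a x) (tensor_scale b x).
Proof.
rewrite tensor_add_class; apply/tensor_classP.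
elim: (tensor_repr x) => [|[m n] s IHs] /=; first exact: TensorRefl.
set A := scale_seq a s in IHs *; set B := scale_seq b s in IHs *.
rewrite -cat1s scalerDl.
apply: TensorTrans (TensorCat (TensorDl _ _ _) IHs) _.
apply: (@TensorCat _ _ _ [:: (a *: m, n)] [:: (a *: m, n)]
         ((b *: m, n) :: A ++ B) (A ++ (b *: m, n) :: B)).
  exact: TensorRefl.
rewrite -[_ :: B]cat1s -cat1s !catA.
by apply: TensorCat; [exact: TensorComm | exact: TensorRefl].
Qed.

Lemma tensor_scale1 x : tensor_scale 1 x = x.
Proof.
rewrite -[RHS]tensor_reprK /tensor_scale /scale_seq; congr tensor_class.
by rewrite -[RHS]map_id; apply: eq_map => -[m n] /=; rewrite scale1r.
Qed.

Lemma tensor_scaleA a b x :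
  tensor_scale a (tensor_scale b x) = tensor_scale (a * b) x.
Proof.
rewrite tensor_scale_class /tensor_scale /scale_seq -map_comp.
by congr tensor_class; apply: eq_map => -[m n] /=; rewrite scalerA.
Qed.

Lemma tensor_scaleDr a x y :
  tensor_scale a (tensor_add x y)
  = tensor_add (tensor_scale a x) (tensor_scale a y).
Proof.
by rewrite tensor_scale_class tensor_add_class /scale_seq map_cat.
Qed.

Lemma tensor_addN : left_inverse tensor_zero tensor_opp tensor_add.
Proof.
move=> x; rewrite -{2}(tensor_scale1 x) -tensor_scaleDl addNr.
exact: tensor_scale0.
Qed.

HB.instance Definition _ :=
  GRing.isZmodule.Build tensor tensor_addA tensor_addC tensor_add0 tensor_addN.

HB.instance Definition _ :=
  GRing.Zmodule_isLmodule.Build R tensor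
    tensor_scaleA tensor_scale1 tensor_scaleDr tensor_scaleDl.

Lemma pure_tensorDl m m' n :
  pure_tensor (m + m') n = pure_tensor m n + pure_tensor m' n.
Proof. by rewrite [RHS]tensor_add_class; exact/tensor_classP/TensorDl. Qed.

Lemma pure_tensorDr m n n' :
  pure_tensor m (n + n') = pure_tensor m n + pure_tensor m n'.
Proof. by rewrite [RHS]tensor_add_class; exact/tensor_classP/TensorDr. Qed.

Lemma pure_tensorZ a m n : pure_tensor (a *: m) n = pure_tensor m (a *: n).
Proof. exact/tensor_classP/TensorZ. Qed.

(* The map M (x) N -> P induced by f; meaningful when f is biadditive and
   satisfies f (a *: m) n = f m (a *: n), see tensor_liftE. *)
Definition tensor_lift (P : zmodType) (f : M -> N -> P) (t : tensor) : P :=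
  \sum_(x <- tensor_repr t) f x.1 x.2.

Section Lift.
Variables (P : zmodType) (f : M -> N -> P).
Hypothesis fDl : forall m m' n, f (m + m') n = f m n + f m' n.
Hypothesis fDr : forall m n n', f m (n + n') = f m n + f m n'.
Hypothesis fZ : forall a m n, f (a *: m) n = f m (a *: n).

Lemma tensor_liftE s : tensor_lift f (tensor_class s) = \sum_(x <- s) f x.1 x.2.
Proof.
suff sum_rel t t' : tensor_rel t t' ->
    \sum_(x <- t) f x.1 x.2 = \sum_(x <- t') f x.1 x.2.
  exact/sum_rel/tensor_repr_rel.
elim=> {s t t'} [||s t u _ -> _ //|s s' t t' _ e _ e'|s t|m m' n|m n n'|b m n|n] //=.
- by rewrite !big_cat /= e e'.
- by rewrite !big_cat /= addrC.
- by rewrite !big_cons !big_nil !addr0 fDl.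
- by rewrite !big_cons !big_nil !addr0 fDr.
- by rewrite !big_cons !big_nil fZ.
- rewrite big_cons !big_nil addr0; apply: (@addrI _ (f 0 n)).
  by rewrite -fDl !addr0.
Qed.

Lemma tensor_lift_pure m n : tensor_lift f (pure_tensor m n) = f m n.
Proof. by rewrite tensor_liftE big_seq1. Qed.
End Lift.

End Tensor.

Definition tensor_map (R : comPzRingType) (M M' N : lmodType R)
    (i : {linear M -> M'}) : tensor M N -> tensor M' N :=
  tensor_lift (fun m n => pure_tensor (i m) n).

Lemma tensor_map_pure (R : comPzRingType) (M M' N : lmodType R)
    (i : {linear M -> M'}) (m : M) (n : N) :
  tensor_map i (pure_tensor m n) = pure_tensor (i m) n.
Proof.
apply: tensor_lift_pure => [m1 m2 n1|m1 n1 n2|a m1 n1].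
- by rewrite linearD pure_tensorDl.
- exact: pure_tensorDr.
- by rewrite linearZ pure_tensorZ.
Qed.

Definition flat_module (R : comPzRingType) (N : lmodType R) : Prop :=
  forall (M M' : lmodType R) (i : {linear M -> M'}),
    injective i -> injective (@tensor_map R M M' N i).

Definition restr_scalars (R S : comPzRingType) (f : {rmorphism R -> S}) : Type :=
  S.

Section RestrScalars.
Variables (R S : comPzRingType) (f : {rmorphism R -> S}).

HB.instance Definition _ := GRing.Zmodule.on (restr_scalars f).

Definition restr_scale (a : R) (x : restr_scalars f) : restr_scalars f :=
  (f a * (x : S) : S).

Lemma restr_scaleA a b x :
  restr_scale a (restr_scale b x) = restr_scale (a * b) x.
Proof. by rewrite /restr_scale rmorphM mulrA. Qed.

Lemma restr_scale1 : left_id 1 restr_scale.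
Proof. by move=> x; rewrite /restr_scale rmorph1 mul1r. Qed.

Lemma restr_scaleDr : right_distributive restr_scale +%R.
Proof. by move=> a x y; exact: mulrDr. Qed.

Lemma restr_scaleDl x : {morph restr_scale^~ x : a b / a + b}.
Proof. by move=> a b; rewrite /restr_scale rmorphD; exact: mulrDl. Qed.

HB.instance Definition _ :=
  GRing.Zmodule_isLmodule.Build R (restr_scalars f)
    restr_scaleA restr_scale1 restr_scaleDr restr_scaleDl.
End RestrScalars.

Definition flat_morphism (R S : comPzRingType) (f : {rmorphism R -> S}) : Prop :=
  flat_module (restr_scalars f).


#[short(type="finTopologicalType")]
HB.structure Definition FinTopological := {T of Finite T & Topological T}.

Record opens (X : topologicalType) :=
  Opens { oset :> set X; oset_open : open oset }.

Definition full (X : topologicalType) : opens X := Opens (@openT X).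

Section MinimalOpen.
Variable X : finTopologicalType.

Definition minset (p : X) : set X := \bigcap_(U in [set U | open U /\ U p]) U.

Lemma minset_open p : open (minset p).
Proof.
rewrite -closedC /minset setC_bigcap.
apply: closed_bigcup => [|U [oU _]]; last by rewrite closedC.
have fin : finite_set [set [set` A] | A in [set: {set X}]].
  exact/finite_image/finite_finset.
apply: sub_finite_set fin => U _; exists [set x | x \in U]%SET => //.
by apply/seteqP; split=> x /=; rewrite !inE.
Qed.

Definition minopen (p : X) : opens X := Opens (@minset_open p).

Lemma minopen_mem p : oset (minopen p) p.
Proof. by move=> U []. Qed.

Lemma minopen_sub (U : opens X) p : oset U p -> minopen p `<=` U.
Proof. by move=> Up x; apply; split => //; exact: oset_open. Qed.
End MinimalOpen.

Definition is_sheaf (X : topologicalType) (F : opens X -> Type)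
    (res : forall U V : opens X, V `<=` U -> F U -> F V) : Prop :=
  [/\ forall (U : opens X) (h : U `<=` U) (s : F U), res U U h s = s,
      forall (U V W : opens X) (hUV : V `<=` U) (hVW : W `<=` V)
        (hUW : W `<=` U) (s : F U),
        res V W hVW (res U V hUV s) = res U W hUW s
    & forall (U : opens X) (I : Type) (V : I -> opens X)
        (hV : forall i, V i `<=` U) (s : forall i, F (V i)),
        (U : set X) = \bigcup_i (V i : set X) ->
        (forall i j (W : opens X) (hi : W `<=` V i) (hj : W `<=` V j),
           res (V i) W hi (s i) = res (V j) W hj (s j)) ->
        exists! t : F U, forall i, res U (V i) (hV i) t = s i].

Record absheaf (X : topologicalType) := AbSheaf {
  asec :> opens X -> zmodType;
  ares : forall U V : opens X, V `<=` U -> {additive asec U -> asec V};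
  ares_sheaf : is_sheaf (fun U V (h : V `<=` U) => ares h : asec U -> asec V)
}.

Record ringsheaf (X : topologicalType) := RingSheaf {
  rsec :> opens X -> comPzRingType;
  rres : forall U V : opens X, V `<=` U -> {rmorphism rsec U -> rsec V};
  rres_sheaf : is_sheaf (fun U V (h : V `<=` U) => rres h : rsec U -> rsec V)
}.

Record omodule (X : topologicalType) (O : ringsheaf X) := OModule {
  msec :> forall U : opens X, lmodType (O U);
  mres : forall U V : opens X, V `<=` U -> {additive msec U -> msec V};
  mresZ : forall (U V : opens X) (h : V `<=` U) (a : O U) (s : msec U),
    mres h (a *: s) = rres O h a *: mres h s;
  mres_sheaf : is_sheaf (fun U V (h : V `<=` U) => mres h : msec U -> msec V)
}.

Definition ab_of_omodule (X : topologicalType) (O : ringsheaf X)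
    (M : omodule O) : absheaf X :=
  @AbSheaf X (fun U => M U) (fun U V h => mres M h) (mres_sheaf M).

Record ab_hom (X : topologicalType) (F G : absheaf X) := AbHom {
  ahom :> forall U : opens X, {additive F U -> G U};
  ahom_res : forall (U V : opens X) (h : V `<=` U) (s : F U),
    ahom V (ares F h s) = ares G h (ahom U s)
}.

(* omod_hom W M N is the module of morphisms M|_W -> N|_W. *)
Record omod_hom (X : topologicalType) (O : ringsheaf X) (W : opens X)
    (M N : omodule O) := OModHom {
  ohom : forall U : opens X, U `<=` W -> {linear M U -> N U};
  ohom_res : forall (U V : opens X) (hU : U `<=` W) (hV : V `<=` W)
    (h : V `<=` U) (s : M U),
    ohom hV (mres M h s) = mres N h (ohom hU s)
}.

Section UnitModule.
Variables (X : topologicalType) (O : ringsheaf X).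

Definition unit_res (U V : opens X) (h : V `<=` U) : (O U)^o -> (O V)^o :=
  rres O h.

Lemma unit_res_additive (U V : opens X) (h : V `<=` U) : zmod_morphism (unit_res h).
Proof. by move=> a b; exact: (rmorphB (rres O h)). Qed.

HB.instance Definition _ (U V : opens X) (h : V `<=` U) :=
  GRing.isZmodMorphism.Build _ _ (unit_res h) (unit_res_additive h).

Lemma unit_resZ (U V : opens X) (h : V `<=` U) (a : O U) (s : (O U)^o) :
  unit_res h (a *: s) = rres O h a *: unit_res h s.
Proof. exact: (rmorphM (rres O h)). Qed.

Definition unit_omodule : omodule O :=
  @OModule X O (fun U => (O U)^o) (fun U V h => unit_res h) unit_resZ
    (rres_sheaf O).
End UnitModule.


Definition fin_supp (R : comPzRingType) (I : Type) : pred (I -> R^o) :=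
  fun f => `[< finite_set [set i | f i != 0] >].

(* The direct sum R^(I) of I copies of R. *)
Section FreeModule.
Variables (R : comPzRingType) (I : Type).

Lemma fin_supp_submod : submod_closed (@fin_supp R I).
Proof.
split=> [|a f g /asboolP ff /asboolP fg]; apply/asboolP.
  by apply: (sub_finite_set _ (finite_set0 I)) => i /=; rewrite eqxx.
have : finite_set ([set i | f i != 0] `|` [set i | g i != 0]).
  by rewrite finite_setU.
apply: sub_finite_set => i /= fgi; case: (eqVneq (f i) 0) => [fi0|]; last by left.
right; apply: contra_neq fgi => gi0.
by rewrite fctE /= scalrfctE fi0 gi0 scaler0 addr0.
Qed.

HB.instance Definition _ :=
  GRing.isSubmodClosed.Build R (I -> R^o) (@fin_supp R I) fin_supp_submod.

Record free_module := FreeModule {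
  free_fun :> I -> R^o; free_finP : fin_supp free_fun }.

HB.instance Definition _ := [isSub for free_fun].
HB.instance Definition _ := [Choice of free_module by <:].
HB.instance Definition _ := [SubChoice_isSubLmodule of free_module by <:].
End FreeModule.

(* U |-> O(U)^(I): on a finite space this presheaf is already a sheaf, hence it
   is the free O-module with basis I. *)
Section FreeOModule.
Variables (X : finTopologicalType) (O : ringsheaf X) (I : Type).

Lemma free_res_subproof (U V : opens X) (h : V `<=` U) (f : free_module (O U) I) :
  fin_supp (fun i => rres O h (f i) : (O V)^o).
Proof.
apply/asboolP; have /asboolP := free_finP f; apply: sub_finite_set => i /=.
by apply: contra_neq => ->; rewrite raddf0.
Qed.

Definition free_res (U V : opens X) (h : V `<=` U) (f : free_module (O U) I) :
    free_module (O V) I :=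
  FreeModule (free_res_subproof h f).

Lemma free_ext (R : comPzRingType) (f g : free_module R I) :
  (forall i, f i = g i) -> f = g.
Proof. by move=> fg; apply/val_inj/funext. Qed.

Lemma free_res_additive (U V : opens X) (h : V `<=` U) :
  zmod_morphism (@free_res U V h).
Proof. by move=> f g; apply: free_ext => i; exact: (rmorphB (rres O h)). Qed.

HB.instance Definition _ (U V : opens X) (h : V `<=` U) :=
  GRing.isZmodMorphism.Build _ _ (@free_res U V h) (@free_res_additive U V h).

Lemma free_resZ (U V : opens X) (h : V `<=` U) (a : O U)
    (f : free_module (O U) I) :
  free_res h (a *: f) = rres O h a *: free_res h f.
Proof. by apply: free_ext => i; exact: (rmorphM (rres O h)). Qed.

Lemma free_sheaf :
  is_sheaf (fun (U V : opens X) (h : V `<=` U) =>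
    @free_res U V h : free_module (O U) I -> free_module (O V) I).
Proof.
have [res1 resD glue] := rres_sheaf O.
split=> [U h f|U V W hUV hVW hUW f|U K V hV s UV sV].
- by apply: free_ext => i; exact: res1.
- by apply: free_ext => i; exact: resD.
have gl i := glue U K V hV (fun k => s k i) UV
  (fun k l W hk hl => congr1 (fun f => free_fun f i) (sV k l W hk hl)).
have [t tP] := choice gl.
pose cov (p : X) : option K :=
  if pselect (exists k, oset (V k) p) is left e then Some (projT1 (cid e))
  else None.
pose supp (p : X) : set I :=
  if cov p is Some k then [set i | s k i != 0] else set0.
have finsupp : finite_set (\bigcup_(p in [set: X]) supp p).
  apply: bigcup_finite => [|p _]; first exact: finite_finset.
  rewrite /supp; case: (cov p) => [k|]; last exact: finite_set0.
  by have /asboolP := free_finP (s k).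
have tfin : fin_supp (t : I -> (O U)^o).
  apply/asboolP; apply: sub_finite_set finsupp => i /= ti0.
  apply: contrapT => ni; move/negP: ti0; apply; apply/eqP.
  pose D := {k : K | exists p, cov p = Some k}.
  have UD : (U : set X) = \bigcup_(d : D) (V (sval d) : set X).
    apply/seteqP; split=> [x Ux|x [d _] /hV //].
    have ex : exists k, oset (V k) x.
      by move: Ux; rewrite UV => -[k _ Vk]; exists k.
    have [k covk Vkx] : exists2 k, cov x = Some k & oset (V k) x.
      rewrite /cov; case: pselect => // e.
      by exists (projT1 (cid e)) => //; exact: projT2 (cid e).
    by exists (exist _ k (ex_intro _ x covk)).
  have s0 (d : D) : s (sval d) i = 0.
    case: d => k [p covp] /=; apply: contrapT => /eqP ski; apply: ni.
    by exists p => //; rewrite /supp covp.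
  have [|u [_ uniq_u]] := glue U D (fun d => V (sval d))
      (fun d => hV (sval d)) (fun d => s (sval d) i) UD.
    move=> k l W hk hl; exact: (congr1 (fun f => free_fun f i) (sV _ _ W hk hl)).
  rewrite -(uniq_u (t i)) => [|d]; last by case: (tP i) => ->.
  by apply: uniq_u => d; rewrite s0 rmorph0.
exists (FreeModule tfin); split=> [k|g gP].
  by apply: free_ext => i /=; have [-> _] := tP i.
apply: free_ext => i /=; have [_] := tP i; apply=> k.
exact: (congr1 (fun f => free_fun f i) (gP k)).
Qed.

Definition free_omodule : omodule O :=
  @OModule X O (fun U => free_module (O U) I)
    (fun U V h => @free_res U V h) free_resZ free_sheaf.
End FreeOModule.

Section FiniteSpaces.
Variables (X : finTopologicalType) (O : ringsheaf X).

(* p <= q in the specialization order means minopen q `<=` minopen p, and the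
   stalk at p of a sheaf is its module of sections over minopen p. *)
Definition finite_space : Prop :=
  forall (p q : X) (h : minopen q `<=` minopen p), flat_morphism (rres O h).

(* M1|_U -> M0|_U -> M|_U -> 0 is exact, i.e. exact on the stalks over U. *)
Definition is_cokernel (U : opens X) (M1 M0 M : omodule O)
    (phi : omod_hom U M1 M0) (psi : omod_hom U M0 M) : Prop :=
  forall (q : X) (Uq : oset U q),
    (forall m : M (minopen q), exists s, ohom psi (minopen_sub Uq) s = m) /\
    (forall s : M0 (minopen q), ohom psi (minopen_sub Uq) s = 0 <->
       exists t, ohom phi (minopen_sub Uq) t = s).

Definition quasi_coherent (M : omodule O) : Prop :=
  forall p : X, exists (U : opens X) (I J : Type)
    (phi : omod_hom U (free_omodule O J) (free_omodule O I))
    (psi : omod_hom U (free_omodule O I) M),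
    oset U p /\ is_cokernel phi psi.

End FiniteSpaces.

Section Cohomology.
Variable X : finTopologicalType.

Definition injective_sheaf (I : absheaf X) : Prop :=
  forall (F G : absheaf X) (i : ab_hom F G) (f : ab_hom F I),
    (forall U, injective (i U)) ->
    exists g : ab_hom G I, forall U s, g U (i U s) = f U s.

Record injective_resolution (F : absheaf X) := InjectiveResolution {
  ires :> nat -> absheaf X;
  iaug : ab_hom F (ires 0%N);
  idiff : forall n, ab_hom (ires n) (ires n.+1);
  ires_injective : forall n, injective_sheaf (ires n);
  iaug_injective : forall p, injective (iaug (minopen p));
  ires_exact0 : forall p (s : ires 0%N (minopen p)),
    idiff 0%N (minopen p) s = 0 <-> exists t, iaug (minopen p) t = s;
  ires_exactS : forall n p (s : ires n.+1 (minopen p)),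
    idiff n.+1 (minopen p) s = 0 <-> exists t, idiff n (minopen p) t = s
}.

(* H^(n+1)(X, F) = 0, where H^i(X, -) is the i-th right derived functor of
   Gamma(X, -) on sheaves of abelian groups, computed on an injective
   resolution of F (the choice of which is immaterial). *)
Definition cohomologyS_vanishes (n : nat) (F : absheaf X) : Prop :=
  exists E : injective_resolution F,
    forall s : E n.+1 (full X), idiff E n.+1 (full X) s = 0 ->
      exists t, idiff E n (full X) t = s.

Definition acyclic (O : ringsheaf X) (M : omodule O) : Prop :=
  forall n, cohomologyS_vanishes n (ab_of_omodule M).
End Cohomology.

Section Affineness.
Variables (X : finTopologicalType) (O : ringsheaf X).

Notation A := (O (full X)).

Definition minopen_full (x : X) : minopen x `<=` full X := @subsetT X _.

(* The natural map Gamma(X, M) (x)_A O_x -> M_x, s (x) a |-> a s_x. *)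
Definition global_to_stalk (M : omodule O) (x : X) :
    tensor (M (full X)) (restr_scalars (rres O (@minopen_full x))) ->
    M (minopen x) :=
  tensor_lift (fun (s : M (full X))
      (a : restr_scalars (rres O (@minopen_full x))) =>
    (a : O (minopen x)) *: mres M (@minopen_full x) s).

Lemma global_to_stalk_pure (M : omodule O) (x : X) (s : M (full X))
    (a : O (minopen x)) :
  global_to_stalk
    (pure_tensor s (a : restr_scalars (rres O (@minopen_full x))))
  = a *: mres M (@minopen_full x) s.
Proof.
apply: tensor_lift_pure => [s1 s2 b|s1 b1 b2|c s1 b].
- by rewrite raddfD scalerDr.
- exact: scalerDl.
- by rewrite mresZ scalerA mulrC.
Qed.

Definition globally_generated (M : omodule O) : Prop :=
  forall (x : X) (m : M (minopen x)), exists t, @global_to_stalk M x t = m.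

Definition acyclic_space : Prop := acyclic (unit_omodule O).

Definition global_hom (M N : omodule O) (f : omod_hom (full X) M N) :
    {linear M (full X) -> N (full X)} :=
  ohom f (@subset_refl _ (full X : set X)).

(* pi_* = Gamma(X, -) : Qcoh(X) -> A-Mod is an equivalence of categories:
   faithful, full and essentially surjective. *)
Definition sections_equivalence : Prop :=
  [/\ forall M N : omodule O, quasi_coherent M -> quasi_coherent N ->
        forall f g : omod_hom (full X) M N, global_hom f =1 global_hom g ->
        forall (U : opens X) (h : U `<=` full X), ohom f h =1 ohom g h,
      forall M N : omodule O, quasi_coherent M -> quasi_coherent N ->
        forall u : {linear M (full X) -> N (full X)},
        exists f : omod_hom (full X) M N, global_hom f =1 u
    & forall E : lmodType A, exists2 M : omodule O, quasi_coherent M &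
        exists u : {linear M (full X) -> E}, bijective u].

Definition affine : Prop := acyclic_space /\ sections_equivalence.

Definition quasi_affine : Prop :=
  forall M : omodule O, quasi_coherent M -> globally_generated M.

Definition serre_affine : Prop :=
  forall M : omodule O, quasi_coherent M -> acyclic M.
End Affineness.

(* Main.v *)
(* On a finite space a sheaf is the functor of its stalks on the specialization preorder,
   and Gamma is the inverse limit.  Embedding a functor F into its Godement functor gode F,
   with cokernel gquo F, computes H^(n+1)(F) as the obstruction to lifting global sections
   along gode (gquo^n F) -> gquo^(n+1) F; this is exact in F, kills injective sheaves, and
   vanishes beyond the cardinality of X, since gquo kills one more layer of points each time.

   Flatness makes the kernel of a surjection from a free module onto a quasi-coherent module
   quasi-coherent again.  If X is acyclic and quasi-affine, then every quasi-coherent M has a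
   presentation 0 -> K -> O^(I) -> M -> 0 with K quasi-coherent and O^(I) acyclic, and
   descending induction on the degree kills all H^(n+1)(M).  If X is quasi-affine and
   Serre-affine, Gamma is exact on such presentations, which yields the equivalence with
   modules over Gamma(X, O).  Conversely, if Gamma is an equivalence, M is a direct factor,
   hence a quotient, of the cokernel obtained from a presentation of Gamma(X, M), hence
   generated by its global sections. *)

Require Import Defs.
From HB Require Import structures.
From mathcomp Require Import all_boot all_order all_algebra.
From mathcomp Require Import generic_quotient finmap all_classical topology.

Set Implicit Arguments.
Unset Strict Implicit.
Unset Printing Implicit Defensive.

Import Order.TTheory GRing.Theory Num.Theory.
Local Open Scope classical_set_scope.
Local Open Scope quotient_scope.
Local Open Scope ring_scope.

(** Vanishing of cohomology is asserted by exhibiting a resolution by injective abelian sheaves, so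
    enough injectives have to be built; they come from powers of Q/Z placed at points. The Godement
    side and the injective side meet in one notion, [relinj]: being a retract of one's own Godement
    functor. Injective sheaves and Godement functors both have this property, [gquo] preserves it,
    and it kills all positive degrees. Any resolution by such functors therefore computes [hvanish],
    without chain maps, homotopies or cohomology groups: only surjectivity on global sections is
    ever tracked.

    Infinite free modules are the second obstacle, because Godement functors are products and
    products need not commute with direct sums. Finiteness of the space saves the argument: finitely
    many indices suffice at all points at once. *)

Lemma dep_choice (T : Type) (U : T -> Type) (P : forall t, U t -> Prop) :
  (forall t, exists u, P t u) -> exists f : forall t, U t, forall t, P t (f t).
Proof. by move=> ex; exists (fun t => sval (cid (ex t))) => t; case: cid. Qed.

Lemma subrACA (V : zmodType) (x y z t : V) : x - y - (z - t) = x - z - (y - t).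
Proof. by rewrite !opprB addrCA [RHS]addrCA [x - y - z]addrAC. Qed.

Definition additive_of (U V : zmodType) (f : U -> V) (fB : zmod_morphism f) :
    {additive U -> V} :=
  HB.pack_for {additive U -> V} f (GRing.isZmodMorphism.Build U V f fB).

Lemma additive_ofE (U V : zmodType) (f : U -> V) (fB : zmod_morphism f) x :
  additive_of fB x = f x.
Proof. by []. Qed.

Lemma zmod_morphism0 (U V : zmodType) (f : U -> V) : zmod_morphism f -> f 0 = 0.
Proof. by move=> fB; have := fB 0 0; rewrite !subrr. Qed.

(** * Cokernels and kernels of groups and modules *)

Section Cokernel.
Variables (U V : zmodType) (f : {additive U -> V}).

Definition coker_rel (x y : V) : bool := `[< exists u, f u = x - y >].

Lemma coker_rel_equiv : equiv_class_of coker_rel.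
Proof.
split=> [x|x y|y x z].
- by apply/asboolP; exists 0; rewrite raddf0 subrr.
- by apply/asboolP/asboolP=> -[u e]; exists (- u); rewrite raddfN e opprB.
- move=> /asboolP[u eu] /asboolP[v ev]; apply/asboolP; exists (u + v).
  by rewrite raddfD eu ev addrA subrK.
Qed.

Canonical coker_equiv := EquivRelPack coker_rel_equiv.

Definition coker : Type := {eq_quot coker_rel}.
HB.instance Definition _ := Choice.on coker.

Definition coker_class (x : V) : coker := \pi_({eq_quot coker_rel}) x.
Definition coker_repr (x : coker) : V := repr (x : {eq_quot coker_rel}).

Lemma coker_classP x y : coker_class x = coker_class y <-> exists u, f u = x - y.
Proof.
split=> [/eqP|xy]; first by rewrite eqmodE => /asboolP.
by apply/eqP; rewrite eqmodE; exact/asboolP.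
Qed.

Lemma coker_reprK x : coker_class (coker_repr x) = x.
Proof. exact: reprK. Qed.

Lemma coker_repr_rel x : exists u, f u = coker_repr (coker_class x) - x.
Proof. by apply/coker_classP; rewrite coker_reprK. Qed.

Definition coker_zero := coker_class 0.
Definition coker_add x y := coker_class (coker_repr x + coker_repr y).
Definition coker_opp x := coker_class (- coker_repr x).

Lemma coker_classD x y :
  coker_add (coker_class x) (coker_class y) = coker_class (x + y).
Proof.
apply/coker_classP; have [u eu] := coker_repr_rel x.
have [v ev] := coker_repr_rel y; exists (u + v).
by rewrite raddfD eu ev opprD addrACA.
Qed.

Lemma coker_addA : associative coker_add.
Proof.
move=> x y z; rewrite -(coker_reprK x) -(coker_reprK y) -(coker_reprK z).
by rewrite !coker_classD addrA.
Qed.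

Lemma coker_addC : commutative coker_add.
Proof. by move=> x y; rewrite /coker_add addrC. Qed.

Lemma coker_add0 : left_id coker_zero coker_add.
Proof. by move=> x; rewrite -(coker_reprK x) coker_classD add0r. Qed.

Lemma coker_addN : left_inverse coker_zero coker_opp coker_add.
Proof.
by move=> x; rewrite -{2}(coker_reprK x) coker_classD addNr.
Qed.

HB.instance Definition _ :=
  GRing.isZmodule.Build coker coker_addA coker_addC coker_add0 coker_addN.

Lemma coker_class_additive : zmod_morphism coker_class.
Proof.
move=> x y; apply: (@addIr _ (coker_class y)); rewrite subrK.
by rewrite [LHS]coker_classD subrK.
Qed.
HB.instance Definition _ :=
  GRing.isZmodMorphism.Build V coker coker_class coker_class_additive.

Lemma coker_class_eq0 x : coker_class x = 0 <-> exists u, f u = x.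
Proof.
by rewrite -(raddf0 coker_class); split=> [/coker_classP|e]; rewrite ?subr0 //;
  apply/coker_classP; rewrite subr0.
Qed.

Lemma coker_class_im u : coker_class (f u) = 0.
Proof. by apply/coker_class_eq0; exists u. Qed.

Section Lift.
Variables (W : zmodType) (g : {additive V -> W}).
Hypothesis gf : forall u, g (f u) = 0.

(* The hypothesis is part of the term so that additivity can be inferred. *)
Definition coker_lift of (forall u, g (f u) = 0) := fun x : coker => g (coker_repr x).

Lemma coker_liftE x : coker_lift gf (coker_class x) = g x.
Proof.
have [u eu] := coker_repr_rel x; apply/eqP; rewrite /coker_lift -subr_eq0 -raddfB.
by rewrite -eu gf.
Qed.

Lemma coker_lift_additive : zmod_morphism (coker_lift gf).
Proof.
move=> x y; rewrite -(coker_reprK x) -(coker_reprK y) -raddfB !coker_liftE.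
exact: raddfB.
Qed.
HB.instance Definition _ :=
  GRing.isZmodMorphism.Build coker W (coker_lift gf) coker_lift_additive.
End Lift.
End Cokernel.

Section LinearCokernel.
Variables (R : comPzRingType) (U V : lmodType R) (f : {linear U -> V}).

Definition lcoker : Type := coker f.
HB.instance Definition _ := GRing.Zmodule.on lcoker.

Definition lcoker_class (x : V) : lcoker := coker_class f x.
HB.instance Definition _ :=
  GRing.isZmodMorphism.Build V lcoker lcoker_class (coker_class_additive f).

Definition lcoker_scale (a : R) (x : lcoker) : lcoker :=
  lcoker_class (a *: coker_repr (x : coker f)).

Lemma lcoker_classZ a x : lcoker_scale a (lcoker_class x) = lcoker_class (a *: x).
Proof.
apply/coker_classP; have [u eu] := coker_repr_rel f x; exists (a *: u).
by rewrite -scalerBr -eu; exact: linearZ.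
Qed.

Lemma lcokerP (x : lcoker) : exists y, lcoker_class y = x.
Proof. by exists (coker_repr (x : coker f)); exact: coker_reprK. Qed.

Lemma lcoker_scaleA a b x : lcoker_scale a (lcoker_scale b x) = lcoker_scale (a * b) x.
Proof. by have [y <-] := lcokerP x; rewrite !lcoker_classZ scalerA. Qed.

Lemma lcoker_scale1 : left_id 1 lcoker_scale.
Proof. by move=> x; have [y <-] := lcokerP x; rewrite !lcoker_classZ scale1r. Qed.

Lemma lcoker_scaleDr : right_distributive lcoker_scale +%R.
Proof.
move=> a x y; have [x' <-] := lcokerP x; have [y' <-] := lcokerP y.
by rewrite -raddfD !lcoker_classZ scalerDr raddfD.
Qed.

Lemma lcoker_scaleDl x : {morph lcoker_scale^~ x : a b / a + b}.
Proof.
move=> a b; have [x' <-] := lcokerP x.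
by rewrite !lcoker_classZ scalerDl raddfD.
Qed.

HB.instance Definition _ :=
  GRing.Zmodule_isLmodule.Build R lcoker
    lcoker_scaleA lcoker_scale1 lcoker_scaleDr lcoker_scaleDl.

Lemma lcoker_class_scalable : scalable lcoker_class.
Proof. by move=> a x; rewrite [RHS]lcoker_classZ. Qed.
HB.instance Definition _ :=
  GRing.isScalable.Build R V lcoker *:%R lcoker_class lcoker_class_scalable.

Lemma lcoker_class_eq0 x : lcoker_class x = 0 <-> exists u, f u = x.
Proof. exact: coker_class_eq0. Qed.
End LinearCokernel.

Section LinearKernel.
Variables (R : comPzRingType) (U V : lmodType R) (f : {linear U -> V}).

Definition lker_pred : pred U := fun x => f x == 0.

Lemma lker_submod : submod_closed lker_pred.
Proof.
split=> [|a x y /eqP fx /eqP fy]; apply/eqP; first by rewrite raddf0.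
by rewrite linearP fx fy scaler0 addr0.
Qed.
HB.instance Definition _ := GRing.isSubmodClosed.Build R U lker_pred lker_submod.

Record lker := LKer { lker_val :> U; lker_valP : lker_pred lker_val }.
HB.instance Definition _ := [isSub for lker_val].
HB.instance Definition _ := [Choice of lker by <:].
HB.instance Definition _ := [SubChoice_isSubLmodule of lker by <:].

Lemma lker0 (x : lker) : f (lker_val x) = 0.
Proof. exact/eqP/(lker_valP x). Qed.

Definition mklker x (fx : f x = 0) : lker := LKer (introT eqP fx).

Lemma lker_val_linear : linear lker_val.
Proof. by []. Qed.
HB.instance Definition _ :=
  GRing.isLinear.Build R lker U *:%R lker_val lker_val_linear.
End LinearKernel.

(** * Injective abelian groups *)

Definition injective_group (D : zmodType) : Prop :=
  forall (A B : zmodType) (i : {additive A -> B}) (f : {additive A -> D}),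
    injective i -> exists g : {additive B -> D}, forall a, g (i a) = f a.

Definition divisible (D : zmodType) : Prop :=
  forall (n : nat) (d : D), (0 < n)%N -> exists d', d' *+ n = d.

Section Baer.
Variables (B D : zmodType) (H0 : set (B * D)).
Hypothesis divD : divisible D.

(* Graphs of partial homomorphisms from B to D extending H0. *)
Definition partial_ext (H : set (B * D)) : Prop :=
  [/\ H0 `<=` H, H (0, 0), forall x y, H x -> H y -> H (x - y)
    & forall d, H (0, d) -> d = 0].

Lemma partial_extN H x : partial_ext H -> H x -> H (- x).
Proof. by case=> _ H00 HB _ Hx; rewrite -sub0r; exact: HB. Qed.

Lemma partial_extD H x y : partial_ext H -> H x -> H y -> H (x + y).
Proof.
move=> PH Hx Hy; case: (PH) => _ _ HB _; rewrite -[y]opprK; apply: HB => //.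
exact: partial_extN.
Qed.

Lemma partial_extMz H x (z : int) : partial_ext H -> H x -> H (x *~ z).
Proof.
move=> PH Hx; have HM n : H (x *+ n).
  elim: n => [|n IHn]; first by case: PH.
  by rewrite mulrS; exact: partial_extD.
case: z => n; first exact: HM.
  by rewrite NegzE mulrNz; exact: (partial_extN PH (HM _)).
Qed.

Lemma pair_mulrz (b : B) (d : D) (z : int) : (b, d) *~ z = (b *~ z, d *~ z).
Proof.
have pairMn n : (b, d) *+ n = (b *+ n, d *+ n).
  by elim: n => [//|n IHn]; rewrite !mulrS IHn.
by case: z => n; [exact: pairMn | rewrite NegzE !mulrNz -!pmulrn pairMn].
Qed.

Lemma partial_ext_fun H b d d' :
  partial_ext H -> H (b, d) -> H (b, d') -> d = d'.
Proof.
case=> _ _ HB HF Hd Hd'; apply/eqP; rewrite -subr_eq0; apply/eqP/HF.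
by have := HB _ _ Hd Hd'; rewrite -[_ - _]/(b - b, d - d') subrr.
Qed.

(** The integers [z] for which [b *~ z] lies in the domain of [H] form an ideal. Divisibility allows
    the value at its positive generator [n] to be divided by [n]; if the ideal is zero, any [d]
    works. *)
Lemma partial_ext_value H b : partial_ext H ->
  exists d, forall (z : int) e, H (b *~ z, e) -> d *~ z = e.
Proof.
move=> PH.
pose P n := (0 < n)%N && `[< exists e, H (b *+ n, e) >].
have [exP|nP] := pselect (exists n, P n); last first.
  exists 0 => z e Hz; rewrite mul0rz.
  suff z0 : z = 0 by move: Hz; rewrite z0 mulr0z; case: PH => _ _ _ HF /HF ->.
  apply: contrapT => z0; apply: nP; exists `|z|%N.
  rewrite /P absz_gt0; apply/andP; split; [exact/eqP | apply/asboolP].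
  have [z_ge0|z_lt0] := lerP 0 z.
    by exists e; rewrite pmulrn gez0_abs.
  by exists (- e); rewrite pmulrn ltz0_abs // mulrNz; exact: (partial_extN PH Hz).
have [n /andP[n_gt0 /asboolP[e0 He0]] n_min] := ex_minnP exP.
have [d de0] := divD e0 n_gt0; exists d => z e Hz.
have zE := divz_eq z n; set q := (z %/ n)%Z in zE; set r := (z %% n)%Z in zE.
have Hq : H (b *~ (q * n), e0 *~ q).
  by rewrite mulrC mulrzA -pmulrn -pair_mulrz; exact: partial_extMz.
have r0 : r = 0.
  have r_ge0 : (0 <= r)%R by rewrite modz_ge0 // -lt0n.
  have r_ltn : (r < n)%R by rewrite ltz_pmod.
  apply: contrapT => /eqP r_neq0.
  suff /n_min : P `|r|%N by rewrite leqNgt -ltz_nat gez0_abs ?r_ltn.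
  rewrite /P absz_gt0 r_neq0; apply/asboolP; exists (e - e0 *~ q).
  rewrite pmulrn gez0_abs // (_ : r = z - q * n); last by rewrite {1}zE addrC addKr.
  by rewrite mulrzBr; case: PH => _ _ HB _; exact: (HB _ _ Hz Hq).
have Ez : z = q * n by rewrite zE r0 addr0.
apply: (partial_ext_fun PH _ Hz).
by move: Hq; rewrite -Ez -de0 pmulrn -mulrzA [n%:Z * q]mulrC -Ez.
Qed.

(** The new graph is [H] enlarged by the multiples of [(b, d)]; the choice of [d] in
    [partial_ext_value] is exactly what keeps it single-valued. *)
Lemma partial_ext_extend H b : partial_ext H ->
  exists H', [/\ partial_ext H', H `<=` H' & exists d, H' (b, d)].
Proof.
move=> PH; have [H0H H00 HB HF] := PH; have [d dP] := partial_ext_value b PH.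
pose H' := [set x | exists y (z : int), H y /\ x = y + (b, d) *~ z].
have sub : H `<=` H' by move=> x Hx; exists x, 0; rewrite mulr0z addr0.
exists H'; split=> //; last first.
  by exists d, 0, 1; rewrite add0r mulr1z.
split=> [||_ _ [y [z [Hy ->]]] [y' [z' [Hy' ->]]]|e [[y1 y2] [z [Hy]]]].
- exact: subset_trans sub.
- exact: sub.
- exists (y - y'), (z - z'); split; first exact: HB.
  by rewrite mulrzBr opprD addrACA.
rewrite pair_mulrz => -[/esym/eqP]; rewrite addrC addr_eq0 => /eqP bz ->.
have /dP -> : H (b *~ z, - y2) by rewrite bz; exact: (partial_extN PH Hy).
by rewrite subrr.
Qed.

Lemma divisible_extend : partial_ext H0 ->
  exists g : {additive B -> D}, forall b d, H0 (b, d) -> g b = d.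
Proof.
move=> PH0.
(* The union of the empty chain must satisfy the property too, hence the alternative [H = set0];
   maximality rules it out afterwards, [H0] being larger. *)
have [|H [HP Hmax]] := @Zorn_bigcup _ (fun H => H = set0 \/ partial_ext H).
  move=> F FP Ftot.
  have [[K0 [FK0 PK0]]|nF] := pselect (exists H, F H /\ partial_ext H); last first.
    left; apply/seteqP; split=> x // [H FH Hx].
    by have [H_0|PH] := FP H FH; [rewrite H_0 in Hx | case: nF; exists H].
  have PF K z : F K -> K z -> partial_ext K by move=> /FP[->|].
  have [H0K K00 _ _] := PK0.
  right; split=> [x /H0K K0x||x y [H FH Hx] [H' FH' Hy]|d [H FH Hd]].
  - by exists K0.
  - by exists K0.
  - have [_ _ HB _] := PF _ _ FH Hx; have [_ _ HB' _] := PF _ _ FH' Hy.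
    case: (Ftot _ _ FH FH') => HH'; [exists H' | exists H] => //.
      by apply: HB' => //; exact: HH'.
    by apply: HB => //; exact: HH'.
  - by have [_ _ _] := PF _ _ FH Hd; apply.
have PH : partial_ext H.
  case: HP => // H_0; case: (Hmax H0); last by right.
  by rewrite H_0; split=> // /(_ (0, 0)); apply; case: PH0.
have tot b : exists d, H (b, d).
  have [H' [PH' HH' [d H'd]]] := partial_ext_extend b PH; exists d.
  apply: contrapT => nHd; apply: (Hmax H'); last by right.
  by split=> // /(_ _ H'd).
have [g gP] := choice tot.
have [H0H _ HB _] := PH.
have g_additive : zmod_morphism g.
  move=> x y; apply: (partial_ext_fun PH (gP _)).
  exact: (HB _ _ (gP x) (gP y)).
by exists (additive_of g_additive) => b d /H0H; exact: (partial_ext_fun PH (gP _)).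
Qed.
End Baer.

(** The extension result is applied to the graph of [f] along [i], which is single-valued because
    [i] is injective. *)
Lemma divisible_injective (D : zmodType) : divisible D -> injective_group D.
Proof.
move=> divD A B i f inj_i.
have [|g gP] := @divisible_extend B D [set (i a, f a) | a in [set: A]] divD.
  split=> // [|_ _ [a _ <-] [b _ <-]|d [a _ [ia <-]]].
  - by exists 0; rewrite // !raddf0.
  - by exists (a - b) => //; rewrite !raddfB.
  - by have -> : a = 0; [apply: inj_i; rewrite ia raddf0 | rewrite raddf0].
by exists g => a; apply: gP; exists a.
Qed.

Lemma injective_group_fun (T : Type) (D : zmodType) :
  injective_group D -> injective_group (T -> D).
Proof.
move=> injD A B i f inj_i.
have ft_additive t : zmod_morphism (fun a => f a t).
  by move=> x y; rewrite raddfB.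
have [g gP] := choice (fun t => injD A B i (additive_of (ft_additive t)) inj_i).
have g_additive : zmod_morphism (fun b t => g t b).
  by move=> x y; apply/funext => t; rewrite raddfB.
by exists (additive_of g_additive) => a; apply/funext => t; exact: gP.
Qed.

Definition int_in_rat : {additive int -> rat} := intmul (1 : rat).
Definition rat_mod_int : zmodType := coker int_in_rat.

Lemma rat_mod_int_divisible : divisible rat_mod_int.
Proof.
move=> n d n_gt0; rewrite -(coker_reprK d); set q := coker_repr d.
exists (coker_class int_in_rat (q / n%:R)); rewrite -raddfMn -[_ *+ n]mulr_natr divfK //.
by rewrite pnatr_eq0 -lt0n.
Qed.

Lemma rat_mod_int_separates (M : zmodType) (m : M) : m != 0 ->
  exists chi : {additive M -> rat_mod_int}, chi m != 0.
Proof.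
move=> m_neq0.
(* The annihilator of [m] must lie in the multiples of [n]: then sending [m *~ z] to the class of
   z/n is well defined on the subgroup generated by [m], and nonzero at [m] since n > 1. The order
   of [m] works, or 2 if the order is infinite. *)
suff [n n_gt1 nP] : exists2 n : nat, (1 < n)%N & forall z : int, m *~ z = 0 -> (n %| z)%Z.
  have n_neq0 : n%:R != 0 :> rat by rewrite pnatr_eq0 -lt0n ltnW.
  pose d : rat_mod_int := coker_class int_in_rat (n%:R^-1).
  have [|chi chiP] := @divisible_extend M rat_mod_int
      [set (m *~ z, d *~ z) | z in [set: int]] rat_mod_int_divisible.
    split=> // [|_ _ [z _ <-] [z' _ <-]|e [z _ [/nP /dvdzP[q ->] <-]]].
    - by exists 0; rewrite ?mulr0z.
    - by exists (z - z') => //; rewrite !mulrzBr.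
    - rewrite -raddfMz; apply/coker_class_eq0; exists q.
      by rewrite -mulrzl rmorphM /= -mulrA divff ?mulr1.
  exists chi; rewrite (chiP m d); last by exists 1; rewrite ?mulr1z.
  apply/eqP => /coker_class_eq0[z /= zn].
  have : z%:~R * n%:R = 1 :> rat by rewrite zn mulVf.
  rewrite -[n%:R]/(n%:~R) -intrM -[1]/(1%:~R) => /intr_inj /eqP.
  move=> /eqP /(congr1 absz); rewrite abszM absz_nat => /eqP.
  by rewrite muln_eq1 => /andP[_ /eqP n1]; rewrite n1 in n_gt1.
have [exn|nex] := pselect (exists n, (0 < n)%N && (m *+ n == 0)); last first.
  exists 2%N => // z mz; suff -> : z = 0 by rewrite dvdz0.
  apply: contrapT => /eqP z_neq0; apply: nex; exists `|z|%N.
  rewrite absz_gt0 z_neq0 pmulrn; have [z_ge0|z_lt0] := lerP 0 z.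
    by rewrite gez0_abs // mz eqxx.
  by rewrite ltz0_abs // mulrNz mz oppr0 eqxx.
have [n /andP[n_gt0 /eqP mn0] n_min] := ex_minnP exn.
exists n => [|z mz].
  case: n n_gt0 mn0 {n_min} => [//|[|//]] _.
  by rewrite mulr1n => m0; rewrite m0 eqxx in m_neq0.
apply/dvdz_mod0P; set r := (z %% n)%Z.
have r_ge0 : (0 <= r)%R by rewrite modz_ge0 // -lt0n.
have r_ltn : (r < n)%R by rewrite ltz_pmod.
apply: contrapT => /eqP r_neq0.
suff /n_min : (0 < `|r|)%N && (m *+ `|r|%N == 0).
  by rewrite leqNgt -ltz_nat gez0_abs ?r_ltn.
rewrite absz_gt0 r_neq0 pmulrn gez0_abs //= /r /modz mulrzBr mz sub0r oppr_eq0.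
by rewrite mulrC mulrzA -pmulrn mn0 mul0rz.
Qed.

(** A power of Q/Z indexed by all characters of [M]. It is not meant to be a minimal injective
    envelope, only an injective group in which [M] embeds. *)
Definition inj_hull (M : zmodType) : zmodType :=
  {additive M -> rat_mod_int} -> rat_mod_int.

Lemma inj_hull_injective M : injective_group (inj_hull M).
Proof. exact/injective_group_fun/divisible_injective/rat_mod_int_divisible. Qed.

Definition to_inj_hull (M : zmodType) (m : M) : inj_hull M := fun chi => chi m.

Lemma to_inj_hull_additive M : zmod_morphism (@to_inj_hull M).
Proof. by move=> x y; apply/funext => chi; exact: raddfB. Qed.
HB.instance Definition _ M :=
  GRing.isZmodMorphism.Build M (inj_hull M) (@to_inj_hull M) (@to_inj_hull_additive M).

Lemma to_inj_hull_inj M : injective (@to_inj_hull M).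
Proof.
apply: raddf_inj => m m0; apply: contrapT => /eqP /rat_mod_int_separates[chi /eqP].
by apply; exact: (congr1 (fun h => h chi) m0).
Qed.

(** * Cohomology of functors on the specialization preorder *)

Section Presheaves.
Variable X : finTopologicalType.

Definition spec (p q : X) : Prop := (minopen q : set X) `<=` minopen p.

Lemma spec_refl p : spec p p.
Proof. exact: subset_refl. Qed.
Arguments spec_refl : clear implicits.

Lemma spec_trans q p r : spec p q -> spec q r -> spec p r.
Proof. by move=> pq qr; exact: subset_trans qr pq. Qed.

Record psh := Psh {
  pob :> X -> zmodType;
  pmap : forall p q, spec p q -> {additive pob p -> pob q};
  pmap_id : forall p (h : spec p p) x, pmap h x = x;
  pmap_comp : forall p q r (h : spec p q) (h' : spec q r) (h'' : spec p r) x,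
    pmap h' (pmap h x) = pmap h'' x
}.

Record pnat (F G : psh) := PNat {
  pnf :> forall p, {additive F p -> G p};
  pnfE : forall p q (h : spec p q) x, pnf q (pmap F h x) = pmap G h (pnf p x)
}.

(** A compatible family is an element of the inverse limit, that is, a global section of the
    associated sheaf. *)
Definition compat (F : psh) (s : forall p, F p) : Prop :=
  forall p q (h : spec p q), pmap F h (s p) = s q.

Lemma compatB (F : psh) (s t : forall p, F p) :
  compat s -> compat t -> compat (fun p => s p - t p).
Proof. by move=> cs ct p q h; rewrite raddfB cs ct. Qed.

Lemma compat_pnat (F G : psh) (f : pnat F G) (s : forall p, F p) :
  compat s -> compat (fun p => f p (s p)).
Proof. by move=> cs p q h; rewrite -pnfE cs. Qed.

Definition gsurj (F G : psh) (f : pnat F G) : Prop :=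
  forall c : (forall p, G p), compat c ->
    exists2 b : forall p, F p, compat b & forall p, f p (b p) = c p.

Definition ses (A B C : psh) (i : pnat A B) (j : pnat B C) : Prop :=
  [/\ forall p, injective (i p), forall p y, j p y = 0 <-> exists x, i p x = y
    & forall p z, exists y, j p y = z].

Section Coker.
Variables (A B : psh) (f : pnat A B).

Lemma pcoker_map_subproof p q (h : spec p q) a :
  (coker_class (f q) \o pmap B h) (f p a) = 0.
Proof. by rewrite /= -pnfE coker_class_im. Qed.

Definition pcoker_map p q (h : spec p q) : {additive coker (f p) -> coker (f q)} :=
  coker_lift (pcoker_map_subproof h).

Lemma pcoker_mapE p q (h : spec p q) x :
  pcoker_map h (coker_class (f p) x) = coker_class (f q) (pmap B h x).
Proof. exact: coker_liftE. Qed.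

Lemma pcoker_id p (h : spec p p) x : pcoker_map h x = x.
Proof. by rewrite -(coker_reprK x) pcoker_mapE pmap_id. Qed.

Lemma pcoker_comp p q r (h : spec p q) (h' : spec q r) (h'' : spec p r) x :
  pcoker_map h' (pcoker_map h x) = pcoker_map h'' x.
Proof. by rewrite -(coker_reprK x) !pcoker_mapE (pmap_comp h h' h''). Qed.

Definition pcoker : psh := Psh pcoker_id pcoker_comp.

Lemma pcoker_proj_subproof p q (h : spec p q) x :
  coker_class (f q) (pmap B h x) = pmap pcoker h (coker_class (f p) x).
Proof. exact/esym/pcoker_mapE. Qed.

Definition pcoker_proj : pnat B pcoker :=
  @PNat B pcoker (fun p => coker_class (f p)) pcoker_proj_subproof.

Lemma pcoker_proj_surj p z : exists y, pcoker_proj p y = z.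
Proof. by exists (coker_repr z); exact: coker_reprK. Qed.

Lemma pcoker_proj_eq0 p y : pcoker_proj p y = 0 <-> exists x, f p x = y.
Proof. exact: coker_class_eq0. Qed.

Lemma pcoker_ses : (forall p, injective (f p)) -> ses f pcoker_proj.
Proof. by split=> // *; [exact: pcoker_proj_eq0 | exact: pcoker_proj_surj]. Qed.

Section Desc.
Variables (C : psh) (g : pnat B C).
Hypothesis gf : forall p x, g p (f p x) = 0.

Lemma pdesc_subproof p q (h : spec p q) x :
  coker_lift (@gf q) (pmap pcoker h x) = pmap C h (coker_lift (@gf p) x).
Proof.
rewrite -(coker_reprK x) -[pmap pcoker h _]/(pcoker_map h _) pcoker_mapE.
by rewrite !coker_liftE pnfE.
Qed.

Definition pdesc : pnat pcoker C :=
  @PNat pcoker C (fun p => coker_lift (@gf p)) pdesc_subproof.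

Lemma pdescE p x : pdesc p (pcoker_proj p x) = g p x.
Proof. exact: coker_liftE. Qed.
End Desc.
End Coker.

Definition pcomp (A B C : psh) (g : pnat B C) (f : pnat A B) : pnat A C.
Proof.
by exists (fun p => (g p \o f p : {additive A p -> C p})) => p q h x /=; rewrite !pnfE.
Defined.

(* Products over all points of the preorder would have nonvanishing cokernels
   forever when the space is not T0, hence this choice of representatives. *)
Definition is_rep (y : X) : Prop :=
  forall z, spec y z -> spec z y -> (enum_rank y <= enum_rank z)%N.

Lemma rep_exists p : exists y, [/\ is_rep y, spec p y & spec y p].
Proof.
pose P q := `[< spec p q /\ spec q p >].
have Pp : P p by apply/asboolP; split; exact: spec_refl.
case: (arg_minnP (fun q => val (enum_rank q)) Pp) => y /asboolP[py yp] ymin.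
exists y; split=> // z yz zy; apply: ymin; apply/asboolP.
by split; [exact: spec_trans py yz | exact: spec_trans zy yp].
Qed.

Lemma rep_unique y z : is_rep y -> is_rep z -> spec y z -> spec z y -> y = z.
Proof.
move=> ry rz yz zy; apply/enum_rank_inj/val_inj/eqP.
by rewrite eqn_leq ry ?rz.
Qed.

Section Product.
Variable J : X -> zmodType.

(** The stalk at [p] of the product, over the representatives [y], of the direct images of [J y]
    from the point [y]. Maps from [F] to this product amount to families of maps from [F y] to
    [J y]; see [to_pprod]. *)
Definition pprod_sec (p : X) : Type := forall y, is_rep y -> spec p y -> J y.
HB.instance Definition _ p := gen_eqMixin (pprod_sec p).
HB.instance Definition _ p := gen_choiceMixin (pprod_sec p).

Lemma pprod_ext p (g g' : pprod_sec p) : (forall y r h, g y r h = g' y r h) -> g = g'.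
Proof.
by move=> gg'; do 3!apply: functional_extensionality_dep => ?; exact: gg'.
Qed.

Definition pprod_add p (g g' : pprod_sec p) : pprod_sec p :=
  fun y r h => g y r h + g' y r h.
Definition pprod_opp p (g : pprod_sec p) : pprod_sec p := fun y r h => - g y r h.
Definition pprod_zero p : pprod_sec p := fun y r h => 0.

Lemma pprod_addA p : associative (@pprod_add p).
Proof. by move=> *; apply: pprod_ext => *; exact: addrA. Qed.
Lemma pprod_addC p : commutative (@pprod_add p).
Proof. by move=> *; apply: pprod_ext => *; exact: addrC. Qed.
Lemma pprod_add0 p : left_id (@pprod_zero p) (@pprod_add p).
Proof. by move=> *; apply: pprod_ext => *; exact: add0r. Qed.
Lemma pprod_addN p : left_inverse (@pprod_zero p) (@pprod_opp p) (@pprod_add p).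
Proof. by move=> *; apply: pprod_ext => *; exact: addNr. Qed.
HB.instance Definition _ p := GRing.isZmodule.Build (pprod_sec p)
  (@pprod_addA p) (@pprod_addC p) (@pprod_add0 p) (@pprod_addN p).

Definition pprod_res p q (h : spec p q) (g : pprod_sec p) : pprod_sec q :=
  fun y r h' => g y r (spec_trans h h').

Lemma pprod_res_additive p q (h : spec p q) : zmod_morphism (pprod_res h).
Proof. by []. Qed.
HB.instance Definition _ p q (h : spec p q) :=
  GRing.isZmodMorphism.Build _ _ (pprod_res h) (pprod_res_additive h).

Lemma pprod_id p (h : spec p p) (g : pprod_sec p) : pprod_res h g = g.
Proof.
by apply: pprod_ext => y r h'; congr (g y r _); exact: Prop_irrelevance.
Qed.

Lemma pprod_comp p q r (h : spec p q) (h' : spec q r) (h'' : spec p r)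
    (g : pprod_sec p) : pprod_res h' (pprod_res h g) = pprod_res h'' g.
Proof.
by apply: pprod_ext => y ry hy; congr (g y ry _); exact: Prop_irrelevance.
Qed.

Definition pprod : psh :=
  @Psh (fun p => pprod_sec p) (fun p q h => pprod_res h) pprod_id pprod_comp.
End Product.

Section ProductMap.
Variables (J J' : X -> zmodType) (f : forall y, {additive J y -> J' y}).

Definition pprod_map_fun p (g : pprod J p) : pprod J' p := fun y r h => f y (g y r h).

Lemma pprod_map_additive p : zmod_morphism (@pprod_map_fun p).
Proof. by move=> g g'; apply: pprod_ext => y r h; exact: raddfB. Qed.
HB.instance Definition _ p :=
  GRing.isZmodMorphism.Build _ _ (@pprod_map_fun p) (@pprod_map_additive p).

Definition pprod_map : pnat (pprod J) (pprod J') :=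
  @PNat (pprod J) (pprod J') (fun p => @pprod_map_fun p) (fun p q h g => erefl).

(** A global section of a product is a free choice of one element per representative, read off on
    the diagonal [c y y]; preimages chosen there are automatically compatible. *)
Lemma pprod_map_gsurj : (forall y z, exists x, f y x = z) -> gsurj pprod_map.
Proof.
move=> fs c cc.
have ex y : exists x : J y, forall r : is_rep y, f y x = c y y r (spec_refl y).
  have [r|nr] := pselect (is_rep y); last by exists 0 => r.
  have [x fx] := fs y (c y y r (spec_refl y)).
  by exists x => r'; rewrite fx (Prop_irrelevance r r').
have [b bP] := dep_choice ex.
exists (fun p y r h => b y) => [p q h //|p]; apply: pprod_ext => y r h.
rewrite [LHS]bP -(cc p y h); congr (c p y r _); exact: Prop_irrelevance.
Qed.

Lemma pprod_map_surj : (forall y z, exists x, f y x = z) ->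
  forall p z, exists x, pprod_map p x = z.
Proof.
move=> fs p z.
have ex y : exists x : J y, forall (r : is_rep y) (h : spec p y), f y x = z y r h.
  have [[r h]|nr] := pselect (is_rep y /\ spec p y); last first.
    by exists 0 => r h; case: nr.
  have [x fx] := fs y (z y r h).
  by exists x => r' h'; rewrite fx (Prop_irrelevance r r') (Prop_irrelevance h h').
have [b bP] := dep_choice ex.
by exists (fun y r h => b y); apply: pprod_ext => y r h; exact: bP.
Qed.
End ProductMap.

Lemma pprod_map_ses (J J' J'' : X -> zmodType) (f : forall y, {additive J y -> J' y})
    (g : forall y, {additive J' y -> J'' y}) :
  (forall y, injective (f y)) ->
  (forall y x, g y x = 0 <-> exists x', f y x' = x) ->
  (forall y z, exists x, g y x = z) ->
  ses (pprod_map f) (pprod_map g).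
Proof.
move=> fi fg gs; split=> [p s t st|p s|]; last exact: pprod_map_surj.
- apply: pprod_ext => y r h; apply: fi.
  exact: (congr1 (fun u : pprod J' p => u y r h) st).
- split=> [gs0|[t <-]]; last first.
    by apply: pprod_ext => y r h; apply/fg; exists (t y r h).
  have ex y : exists x : J y, forall (r : is_rep y) (h : spec p y), f y x = s y r h.
    have [[r h]|nr] := pselect (is_rep y /\ spec p y); last first.
      by exists 0 => r h; case: nr.
    have /fg[x fx] : g y (s y r h) = 0.
      exact: (congr1 (fun u : pprod J'' p => u y r h) gs0).
    by exists x => r' h'; rewrite fx (Prop_irrelevance r r') (Prop_irrelevance h h').
  have [b bP] := dep_choice ex.
  by exists (fun y r h => b y); apply: pprod_ext => y r h; exact: bP.
Qed.

Section ToProduct.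
Variables (F : psh) (J : X -> zmodType) (f : forall y, {additive F y -> J y}).

Definition to_pprod_fun p (x : F p) : pprod J p := fun y r h => f y (pmap F h x).

Lemma to_pprod_additive p : zmod_morphism (@to_pprod_fun p).
Proof. by move=> x x'; apply: pprod_ext => y r h; rewrite /to_pprod_fun !raddfB. Qed.
HB.instance Definition _ p :=
  GRing.isZmodMorphism.Build _ _ (@to_pprod_fun p) (@to_pprod_additive p).

Lemma to_pprod_subproof p q (h : spec p q) x :
  to_pprod_fun (pmap F h x) = pmap (pprod J) h (to_pprod_fun x).
Proof. by apply: pprod_ext => y r h'; congr (f y _); exact: pmap_comp. Qed.

Definition to_pprod : pnat F (pprod J) :=
  @PNat F (pprod J) (fun p => @to_pprod_fun p) to_pprod_subproof.

(** Restriction from [p] to its representative is invertible, so that component alone detects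
    [x]. *)
Lemma to_pprod_inj : (forall y, injective (f y)) -> forall p, injective (to_pprod p).
Proof.
move=> fi p; apply: raddf_inj => x x0.
have [y [r py yp]] := rep_exists p.
have : f y (pmap F py x) = 0 by exact: (congr1 (fun u : pprod J p => u y r py) x0).
rewrite -(raddf0 (f y)) => /fi px.
by rewrite -[x](pmap_id (spec_refl p)) -(pmap_comp py yp) px raddf0.
Qed.
End ToProduct.

(** * The Godement resolution *)

Definition gode (F : psh) : psh := pprod F.
Definition gunit (F : psh) : pnat F (gode F) := to_pprod (fun y => idfun).
Definition gquo (F : psh) : psh := pcoker (gunit F).
Definition gproj (F : psh) : pnat (gode F) (gquo F) := pcoker_proj (gunit F).
Definition gmap (F G : psh) (f : pnat F G) : pnat (gode F) (gode G) := pprod_map f.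

Lemma gunit_inj F p : injective (gunit F p).
Proof. by apply: to_pprod_inj. Qed.

Lemma gproj_gunit F p x : gproj F p (gunit F p x) = 0.
Proof. exact: coker_class_im. Qed.

Lemma gmap_gunit F G (f : pnat F G) p x : gmap f p (gunit F p x) = gunit G p (f p x).
Proof. by apply: pprod_ext => y r h; exact: pnfE. Qed.

Lemma gqmap_subproof F G (f : pnat F G) p x :
  pcomp (gproj G) (gmap f) p (gunit F p x) = 0.
Proof.
by rewrite -[LHS]/(gproj G p (gmap f p (gunit F p x))) gmap_gunit gproj_gunit.
Qed.

Definition gqmap F G (f : pnat F G) : pnat (gquo F) (gquo G) :=
  pdesc (gqmap_subproof f).

Lemma gqmapE F G (f : pnat F G) p g : gqmap f p (gproj F p g) = gproj G p (gmap f p g).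
Proof. exact: pdescE. Qed.

(** The nine lemma at each point, with columns F -> gode F -> gquo F; the middle row is exact
    because products are. *)
Lemma gqmap_ses A B C (i : pnat A B) (j : pnat B C) :
  ses i j -> ses (gqmap i) (gqmap j).
Proof.
move=> [inj_i ex_ij surj_j].
have [inj_gi ex_gij surj_gj] := pprod_map_ses inj_i ex_ij surj_j.
rewrite -[pprod_map i]/(gmap i) -[pprod_map j]/(gmap j) in inj_gi ex_gij surj_gj.
have ji p x : j p (i p x) = 0 by apply/ex_ij; exists x.
split=> [p|p y|p z].
- apply: raddf_inj => x; have [g <-] := pcoker_proj_surj x.
  rewrite gqmapE => /pcoker_proj_eq0[b eb].
  have jb0 : j p b = 0.
    apply: (@gunit_inj C p); rewrite -gmap_gunit eb raddf0.
    by apply/ex_gij; exists g.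
  have [a ea] := (ex_ij p b).1 jb0.
  apply/pcoker_proj_eq0; exists a; apply: inj_gi.
  by rewrite gmap_gunit ea.
- have [g <-] := pcoker_proj_surj y; rewrite gqmapE; split=> [/pcoker_proj_eq0[c ec]|[x]].
    have [b eb] := surj_j p c.
    have /ex_gij[a ea] : gmap j p (g - gunit B p b) = 0.
      by rewrite raddfB gmap_gunit eb ec subrr.
    exists (gproj A p a); rewrite gqmapE ea raddfB gproj_gunit subr0 //.
  have [a <-] := pcoker_proj_surj x; rewrite gqmapE => e.
  rewrite -gqmapE -e gqmapE; have -> : gmap j p (gmap i p a) = 0.
    by apply/ex_gij; exists a.
  by rewrite raddf0.
- have [g <-] := pcoker_proj_surj z; have [b eb] := surj_gj p g.
  by exists (gproj B p b); rewrite gqmapE eb.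
Qed.

End Presheaves.
Arguments spec_refl {X} p.

(** * Dimension shifting along short exact sequences *)

Section Vanishing.
Variable X : finTopologicalType.
Implicit Types A B C F G : psh X.

(* H^(n+1)(X, F) = 0, computed on the Godement resolution by dimension shifting. *)
Definition hvanish (n : nat) F : Prop := gsurj (gproj (iter n (@gquo X) F)).

Lemma compat_inj F G (f : pnat F G) (s : forall p, F p) :
  (forall p, injective (f p)) -> compat (fun p => f p (s p)) -> compat s.
Proof. by move=> fi cs p q h; apply: fi; rewrite pnfE cs. Qed.

Lemma ses_comp0 A B C (i : pnat A B) (j : pnat B C) p x : ses i j -> j p (i p x) = 0.
Proof. by case=> _ ex _; apply/ex; exists x. Qed.

Lemma ses_compat_lift A B C (i : pnat A B) (j : pnat B C) (b : forall p, B p) :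
  ses i j -> compat b -> (forall p, j p (b p) = 0) ->
  exists2 a, compat a & forall p, i p (a p) = b p.
Proof.
move=> [inj_i ex_ij _] cb jb.
have [a aP] := dep_choice (fun p => (ex_ij p (b p)).1 (jb p)).
exists a => //; apply: (compat_inj inj_i) => p q h; rewrite !aP; exact: cb.
Qed.

Lemma gunit_ses F : ses (gunit F) (gproj F).
Proof. exact/pcoker_ses/gunit_inj. Qed.

Lemma gmap_ses A B C (i : pnat A B) (j : pnat B C) : ses i j -> ses (gmap i) (gmap j).
Proof. by case=> inj_i ex_ij surj_j; exact: pprod_map_ses. Qed.

Lemma gmap_gsurj A B C (i : pnat A B) (j : pnat B C) : ses i j -> gsurj (gmap j).
Proof. by case=> _ _ surj_j; exact: pprod_map_gsurj. Qed.

(** The connecting map by hand: [c] lifts to [gode B], and the class of the lift in [gquo B] comes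
    from a global section of [gquo A]. This obstruction lifts to [gode A] by hypothesis, and
    subtracting the lift leaves a section of [B]. *)
Lemma ses_gsurj A B C (i : pnat A B) (j : pnat B C) :
  ses i j -> hvanish 0 A -> gsurj j.
Proof.
move=> S vA c cc.
have [b cb bP] := gmap_gsurj S (compat_pnat (gunit C) cc).
have [||a' ca' a'P] := ses_compat_lift (b := fun p => gproj B p (b p)) (gqmap_ses S).
- exact: compat_pnat.
- by move=> p; rewrite gqmapE bP gproj_gunit.
have [a ca aP] := vA _ ca'.
have [||x cx xP] := ses_compat_lift (b := fun p => b p - gmap i p (a p)) (gunit_ses B).
- by apply: compatB => //; exact: compat_pnat.
- by move=> p; rewrite raddfB -gqmapE aP a'P subrr.
exists x => // p; apply: (@gunit_inj _ C p).
by rewrite -gmap_gunit xP raddfB bP (ses_comp0 _ (gmap_ses S)) subr0.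
Qed.

(** Exactness of H^0(B) -> H^0(C) -> H^1(A) -> H^1(B): a lift of [a] to [gode B] maps in [gode C] to
    a section of [C]; a preimage of the latter in [B] is subtracted to land in [gode A]. *)
Lemma hvanish0_sub A B C (i : pnat A B) (j : pnat B C) :
  ses i j -> hvanish 0 B -> gsurj j -> hvanish 0 A.
Proof.
move=> S vB js a ca.
have [b cb bP] := vB _ (compat_pnat (gqmap i) ca).
have [||c cc cP] := ses_compat_lift (b := fun p => gmap j p (b p)) (gunit_ses C).
- exact: compat_pnat.
- by move=> p; rewrite -gqmapE bP (ses_comp0 _ (gqmap_ses S)).
have [b' cb' b'P] := js c cc.
have [||a' ca' a'P] :=
    ses_compat_lift (b := fun p => b p - gunit B p (b' p)) (gmap_ses S).
- by apply: compatB => //; exact: compat_pnat.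
- by move=> p; rewrite raddfB gmap_gunit b'P cP subrr.
exists a' => // p; have [inj_qi _ _] := gqmap_ses S.
by apply: inj_qi; rewrite gqmapE a'P raddfB gproj_gunit subr0 bP.
Qed.

Lemma gquo_gsurj A B C (i : pnat A B) (j : pnat B C) :
  ses i j -> hvanish 0 C -> gsurj (gqmap j).
Proof.
move=> S vC c /vC[g cg gP]; have [b cb bP] := gmap_gsurj S cg.
exists (fun p => gproj B p (b p)); first exact: compat_pnat.
by move=> p; rewrite gqmapE bP gP.
Qed.

Definition exses A B C : Prop := exists (i : pnat A B) (j : pnat B C), ses i j.

Lemma iter_exses n A B C : exses A B C ->
  exses (iter n (@gquo X) A) (iter n (@gquo X) B) (iter n (@gquo X) C).
Proof.
move=> S; elim: n => //= n [i [j S']].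
by exists (gqmap i), (gqmap j); exact: gqmap_ses.
Qed.

(** The exact piece H^(n+1)(B) -> H^(n+1)(C) -> H^(n+2)(A), reduced to the lowest degree by applying
    [gquo] [n] times. *)
Lemma hvanish_quo n A B C :
  exses A B C -> hvanish n B -> hvanish n.+1 A -> hvanish n C.
Proof.
move=> /(iter_exses n)[i [j S]] vB vA c cc.
have [b cb bP] := ses_gsurj (gqmap_ses S) vA cc.
have [g cg gP] := vB _ cb.
exists (fun p => gmap j p (g p)); first exact: compat_pnat.
by move=> p; rewrite -gqmapE gP bP.
Qed.

(** The exact piece H^(n+1)(C) -> H^(n+2)(A) -> H^(n+2)(B). *)
Lemma hvanish_sub n A B C :
  exses A B C -> hvanish n C -> hvanish n.+1 B -> hvanish n.+1 A.
Proof.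
move=> /(iter_exses n)[i [j S]] vC vB.
exact: (hvanish0_sub (gqmap_ses S) vB (gquo_gsurj S vC)).
Qed.

Lemma gproj_surj F p (x : gquo F p) : exists g, gproj F p g = x.
Proof. exact: pcoker_proj_surj. Qed.

Definition relinj F : Prop :=
  exists r : pnat (gode F) F, forall p x, r p (gunit F p x) = x.

(** The element [g - gunit (r g)] depends only on the class of [g] in [gquo F]. It is thus a
    canonical lift of that class, and canonical lifts are compatible with restriction. *)
Lemma relinj_hvanish0 F : relinj F -> hvanish 0 F.
Proof.
move=> [r rP] c cc.
have [b bP] := dep_choice (fun p => pcoker_proj_surj (c p)).
have sec_eq p (g g' : gode F p) : gproj F p g = gproj F p g' ->
    g - gunit F p (r p g) = g' - gunit F p (r p g').
  move=> /eqP; rewrite -subr_eq0 -raddfB => /eqP/pcoker_proj_eq0[x xP].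
  apply/eqP; rewrite -subr_eq0 subrACA -!raddfB -xP rP subrr //.
exists (fun p => b p - gunit F p (r p (b p))) => [p q h|p]; last first.
  by rewrite raddfB gproj_gunit subr0; exact: bP.
rewrite raddfB -!pnfE; apply: sec_eq; rewrite pnfE [X in pmap _ _ X]bP cc.
exact/esym/bP.
Qed.

(** The retraction evaluates on the diagonal: from the component of [g] at [y] it keeps the entry at
    [y] itself. *)
Lemma relinj_gode F : relinj (gode F).
Proof.
pose r p (g : gode (gode F) p) : gode F p := fun y ry h => g y ry h y ry (spec_refl y).
have r_additive p : zmod_morphism (@r p) by [].
pose R p := additive_of (r_additive p).
have RE p q (h : spec p q) g : R q (pmap (gode (gode F)) h g) = pmap (gode F) h (R p g).
  by [].
exists (PNat RE) => p g; apply: pprod_ext => y ry h.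
by congr (g y ry _); exact: Prop_irrelevance.
Qed.

Lemma relinj_retract F G (a : pnat F G) (b : pnat G F) :
  (forall p x, b p (a p x) = x) -> relinj G -> relinj F.
Proof.
move=> ba [r rP]; exists (pcomp b (pcomp r (gmap a))) => p x.
by rewrite -[LHS]/(b p (r p (gmap a p (gunit F p x)))) gmap_gunit rP ba.
Qed.

Definition pid F : pnat F F := @PNat X F F (fun p => idfun) (fun p q h x => erefl).

Definition psub F G (f g : pnat F G) : pnat F G.
Proof.
by exists (fun p => (f p \- g p : {additive F p -> G p})) => p q h x; rewrite /= !pnfE raddfB.
Defined.

(** The map 1 - gunit r kills the image of [gunit], hence descends to a section of [gproj]: [gquo F]
    is a direct factor of [gode F]. *)
Lemma relinj_gquo F : relinj F -> relinj (gquo F).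
Proof.
move=> [r rP]; pose s := psub (pid (gode F)) (pcomp (gunit F) r).
have s0 p x : s p (gunit F p x) = 0 by rewrite /s /= rP subrr.
apply: (relinj_retract (a := pdesc s0) (b := gproj F)); last exact: relinj_gode.
move=> p x; have [g <-] := pcoker_proj_surj x.
by rewrite pdescE /s raddfB gproj_gunit subr0.
Qed.

Lemma relinj_hvanish n F : relinj F -> hvanish n F.
Proof.
move=> rF; apply: relinj_hvanish0; elim: n => //= n.
exact: relinj_gquo.
Qed.

(** * Vanishing above the dimension *)

(** A cardinality rather than a length of chains: it also drops along strict relations and is
    bounded by the size of [X], which is all the vanishing bound requires. *)
Definition height (p : X) : nat := #|[pred q | `[< spec p q /\ ~ spec q p >]]|.

Lemma height_lt p q : spec p q -> ~ spec q p -> (height q < height p)%N.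
Proof.
move=> pq nqp; apply/proper_card/properP; split.
  apply/fintype.subsetP => r; rewrite !inE => -[qr nrq].
  split=> [|rp]; [exact: spec_trans pq qr | apply: nrq; exact: spec_trans rp pq].
exists q; first by rewrite inE.
by apply/negP; rewrite inE => -[_]; apply; exact: spec_refl.
Qed.

Definition zero_below (n : nat) F : Prop :=
  forall p, (height p < n)%N -> forall x : F p, x = 0.

(** At a point [p] of height at most [n], the points strictly beyond [p] have height below [n],
    where [F] is zero. Only the unique representative [y0] of [p] contributes to [gode F] at [p], so
    [gunit] is onto there. *)
Lemma zero_below_gquo n F : zero_below n F -> zero_below n.+1 (gquo F).
Proof.
move=> F0 p hp x; have [g <-] := pcoker_proj_surj x.
apply/pcoker_proj_eq0.
have [y0 [r0 py0 y0p]] := rep_exists p.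
exists (pmap F y0p (g y0 r0 py0)); apply: pprod_ext => y r py.
have [yp|nyp] := pselect (spec y p).
  have e : y = y0.
    by apply: rep_unique => //; [exact: spec_trans yp py0 | exact: spec_trans y0p py].
  subst y0; rewrite /= /to_pprod_fun /= (pmap_comp y0p py (spec_refl y)) pmap_id.
  by rewrite (Prop_irrelevance r r0) (Prop_irrelevance py py0).
have hy : (height y < n)%N by exact: leq_trans (height_lt py nyp) hp.
by rewrite [LHS]F0 // [RHS]F0.
Qed.

Lemma hvanish_dim F n : (#|X| < n)%N -> hvanish n F.
Proof.
move=> Xn; have Z : zero_below n (iter n (@gquo X) F).
  by elim: (n) => [|k IHk] //=; exact: zero_below_gquo.
move=> c cc; exists (fun p => 0) => [p q h|p]; rewrite ?raddf0 //.
apply/esym/(zero_below_gquo Z); rewrite ltnS.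
by apply: leq_trans (ltnW Xn); exact: max_card.
Qed.

(** * Direct sums *)

(* Abstracts D = F^(I).  The sum need not be direct: in this form the property passes
   to gode and gquo without identifying them with direct sums. *)
Definition sum_decomp D F (I : choiceType) (e : I -> pnat F D) (pr : I -> pnat D F) :=
  forall p (x : D p), exists s : seq I, forall t : seq I, uniq t -> {subset s <= t} ->
    x = \sum_(i <- t) e i p (pr i p x).

Definition sumlike D F : Prop :=
  exists (I : choiceType) (e : I -> pnat F D) (pr : I -> pnat D F), sum_decomp e pr.

(** Finitely many supports lie in a single one. Quantifying over all larger duplicate-free lists is
    what allows supports to be merged. *)
Lemma common_supp (T : finType) (I : eqType) (P : T -> seq I -> Prop) :
  (forall y, exists s : seq I, forall t : seq I, uniq t -> {subset s <= t} -> P y t) ->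
  exists s : seq I, forall t : seq I, uniq t -> {subset s <= t} -> forall y, P y t.
Proof.
move=> /choice[s sP]; exists (flatten [seq s y | y <- enum T]) => t ut st y.
apply: sP => // i iy; apply: st; apply/flatten_mapP; exists y => //.
by rewrite mem_enum.
Qed.

Lemma sum_decomp_gode D F (I : choiceType) (e : I -> pnat F D) (pr : I -> pnat D F) :
  sum_decomp e pr -> sum_decomp (fun i => gmap (e i)) (fun i => gmap (pr i)).
Proof.
move=> eP p g.
pose P y t := forall (r : is_rep y) (h : spec p y),
  g y r h = \sum_(i <- t) e i y (pr i y (g y r h)).
have [y|s sP] := @common_supp X I P.
  have [[r h]|nr] := pselect (is_rep y /\ spec p y); last first.
    by exists [::] => t _ _ r h; case: nr.
  have [s sP] := eP y (g y r h); exists s => t ut st r' h'.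
  by rewrite (Prop_irrelevance r' r) (Prop_irrelevance h' h); exact: sP.
exists s => t ut st; apply: pprod_ext => y r h.
rewrite [LHS](sP t ut st y r h).
have eval_additive : zmod_morphism (fun u : gode D p => u y r h) by [].
by rewrite -[RHS]/(additive_of eval_additive _) raddf_sum; apply: eq_bigr.
Qed.

Lemma sum_decomp_gquo D F (I : choiceType) (e : I -> pnat F D) (pr : I -> pnat D F) :
  sum_decomp e pr -> sum_decomp (fun i => gqmap (e i)) (fun i => gqmap (pr i)).
Proof.
move=> /sum_decomp_gode eP p x; have [g <-] := gproj_surj x.
have [s sP] := eP p g; exists s => t ut st.
rewrite {1}(sP t ut st) raddf_sum; apply: eq_bigr => i _.
by rewrite !gqmapE.
Qed.

(** The components of [c] under the projections lift separately; the lifts are pushed back by the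
    [e i] and added over a finite set of indices valid at all points. *)
Lemma hvanish_sumlike n D F : sumlike D F -> hvanish n F -> hvanish n D.
Proof.
move=> DF; have {DF} : sumlike (iter n (@gquo X) D) (iter n (@gquo X) F).
  elim: n => //= n [I [e [pr eP]]]; exists I, (fun i => gqmap (e i)), (fun i => gqmap (pr i)).
  exact: sum_decomp_gquo.
rewrite /hvanish; move: (iter n _ D) (iter n _ F) => {}D {}F [I [e [pr eP]]] vF c cc.
have [p|s sP] := @common_supp X I
    (fun p t => c p = \sum_(i <- t) gqmap (e i) p (gqmap (pr i) p (c p))).
  exact: (sum_decomp_gquo eP).
have ex i : exists b : (forall p, gode F p),
    compat b /\ forall p, gproj F p (b p) = gqmap (pr i) p (c p).
  by have [b cb bP] := vF _ (compat_pnat (gqmap (pr i)) cc); exists b.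
have [g gP] := dep_choice ex.
exists (fun p => \sum_(i <- undup s) gmap (e i) p (g i p)) => [p q h|p].
  by rewrite raddf_sum; apply: eq_bigr => i _; rewrite -pnfE; have [-> _] := gP i.
rewrite raddf_sum [RHS](sP _ (undup_uniq s)) => [|i]; last by rewrite mem_undup.
by apply: eq_bigr => i _; have [_ <-] := gP i; rewrite gqmapE.
Qed.
End Vanishing.

(** * Sheaves and their stalks *)

Section SheafStalks.
Variables (X : finTopologicalType) (F : opens X -> Type).
Variable res : forall U V : opens X, V `<=` U -> F U -> F V.
Hypothesis sheafF : is_sheaf res.

Lemma sheaf_sep (U : opens X) (s t : F U) :
  (forall p (hp : oset U p), res (minopen_sub hp) s = res (minopen_sub hp) t) -> s = t.
Proof.
move=> st; have [_ resD glue] := sheafF.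
have UE : (U : set X) = \bigcup_(i : {p | oset U p}) (minopen (sval i) : set X).
  apply/seteqP; split=> [p Up|p [[q Uq] _ /=]]; last exact: minopen_sub.
  by exists (exist _ p Up) => //; exact: minopen_mem.
have [|u [_ uniq_u]] := glue U {p | oset U p} (fun i => minopen (sval i))
   (fun i => minopen_sub (svalP i)) (fun i => res (minopen_sub (svalP i)) s) UE.
  move=> i j W hi hj; have hU : W `<=` U := subset_trans hi (minopen_sub (svalP i)).
  by rewrite !(resD _ _ _ _ _ hU).
by rewrite -(uniq_u s) // (uniq_u t) // => i; rewrite st.
Qed.

(** The minimal opens of the points of [U] cover [U]; agreement on an overlap is tested, by
    separatedness, on the minimal opens of its own points. *)
Lemma sheaf_glue (U : opens X) (s : forall p, oset U p -> F (minopen p)) :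
  (forall p q (hp : oset U p) (hq : oset U q) (h : spec p q), res h (s p hp) = s q hq) ->
  exists t : F U, forall p (hp : oset U p), res (minopen_sub hp) t = s p hp.
Proof.
move=> cs; have [_ resD glue] := sheafF.
have UE : (U : set X) = \bigcup_(i : {p | oset U p}) (minopen (sval i) : set X).
  apply/seteqP; split=> [p Up|p [[q Uq] _ /=]]; last exact: minopen_sub.
  by exists (exist _ p Up) => //; exact: minopen_mem.
have [|u [uP _]] := glue U {p | oset U p} (fun i => minopen (sval i))
   (fun i => minopen_sub (svalP i)) (fun i => s (sval i) (svalP i)) UE.
  move=> [i Ui] [j Uj] W /= hi hj; apply: sheaf_sep => p hp.
  have hip : spec i p := subset_trans (minopen_sub hp) hi.
  have hjp : spec j p := subset_trans (minopen_sub hp) hj.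
  have Up : oset U p := minopen_sub Ui (hi _ hp).
  by rewrite (resD _ _ _ _ _ hip) (resD _ _ _ _ _ hjp) (cs _ _ _ Up) (cs _ _ _ Up).
exists u => p hp; have := uP (exist (fun p => oset U p) p hp).
by rewrite (Prop_irrelevance (svalP (exist (fun p => oset U p) p hp)) hp).
Qed.
End SheafStalks.

Section PshOfSheaf.
Variable X : finTopologicalType.

Section Stalks.
Variable F : absheaf X.

Lemma ares_id (U : opens X) (h : U `<=` U) (s : F U) : ares F h s = s.
Proof. by case: (ares_sheaf F) => + _ _; apply. Qed.

Lemma ares_comp (U V W : opens X) (h : V `<=` U) (h' : W `<=` V) (h'' : W `<=` U)
  (s : F U) : ares F h' (ares F h s) = ares F h'' s.
Proof. by case: (ares_sheaf F) => _ + _; apply. Qed.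

Definition psh_of : psh X :=
  @Psh X (fun p => F (minopen p)) (fun p q h => ares F h)
    (fun p h x => ares_id h x) (fun p q r h h' h'' x => ares_comp h h' h'' x).

Lemma psh_of_global (s : forall p, psh_of p) : compat s ->
  exists t : F (full X), forall p, ares F (@minopen_full X p) t = s p.
Proof.
move=> cs; have [|t tP] := sheaf_glue (ares_sheaf F) (U := full X) (s := fun p _ => s p).
  by move=> p q _ _ h; exact: cs.
by exists t => p; rewrite -(tP p I); congr (ares F _ t); exact: Prop_irrelevance.
Qed.

Lemma compat_global (t : F (full X)) :
  @compat X psh_of (fun p => ares F (@minopen_full X p) t).
Proof. by move=> p q h; exact: ares_comp. Qed.

Lemma global_sep (s t : F (full X)) :
  (forall p, ares F (@minopen_full X p) s = ares F (@minopen_full X p) t) ->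
  s = t.
Proof.
move=> st; apply: (sheaf_sep (ares_sheaf F)) => p hp.
rewrite (Prop_irrelevance (minopen_sub hp) (@minopen_full X p)); exact: st.
Qed.
End Stalks.

Definition psh_map (F G : absheaf X) (f : ab_hom F G) : pnat (psh_of F) (psh_of G) :=
  @PNat X (psh_of F) (psh_of G) (fun p => f (minopen p)) (fun p q h x => ahom_res f h x).
End PshOfSheaf.

(** * The sheaf attached to a functor *)

Section SheafOfPsh.
Variables (X : finTopologicalType) (P : psh X).

Record sec (U : opens X) := Sec {
  sec_fun :> forall p, oset U p -> P p;
  sec_compat : forall p q (hp : oset U p) (hq : oset U q) (h : spec p q),
    pmap P h (@sec_fun p hp) = @sec_fun q hq
}.
HB.instance Definition _ U := gen_eqMixin (sec U).
HB.instance Definition _ U := gen_choiceMixin (sec U).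

Lemma sec_ext U (s t : sec U) : (forall p hp, s p hp = t p hp) -> s = t.
Proof.
move=> st; case: s t st => [s cs] [t ct] /= st.
have e : s = t by do 2!apply: functional_extensionality_dep => ?.
by subst t; congr Sec; exact: Prop_irrelevance.
Qed.

Lemma sec_irr U (s : sec U) p (hp hp' : oset U p) : s p hp = s p hp'.
Proof. by congr (s p _); exact: Prop_irrelevance. Qed.

Definition sec_zero U : sec U.
Proof. by exists (fun p _ => 0) => *; exact: raddf0. Defined.
Definition sec_opp U (s : sec U) : sec U.
Proof.
by exists (fun p hp => - s p hp) => p q hp hq h; rewrite raddfN (sec_compat s hp hq).
Defined.
Definition sec_add U (s t : sec U) : sec U.
Proof.
exists (fun p hp => s p hp + t p hp) => p q hp hq h.
by rewrite raddfD (sec_compat s hp hq) (sec_compat t hp hq).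
Defined.

Lemma sec_addA U : associative (@sec_add U).
Proof. by move=> *; apply: sec_ext => *; exact: addrA. Qed.
Lemma sec_addC U : commutative (@sec_add U).
Proof. by move=> *; apply: sec_ext => *; exact: addrC. Qed.
Lemma sec_add0 U : left_id (sec_zero U) (@sec_add U).
Proof. by move=> *; apply: sec_ext => *; exact: add0r. Qed.
Lemma sec_addN U : left_inverse (sec_zero U) (@sec_opp U) (@sec_add U).
Proof. by move=> *; apply: sec_ext => *; exact: addNr. Qed.
HB.instance Definition _ U := GRing.isZmodule.Build (sec U)
  (@sec_addA U) (@sec_addC U) (@sec_add0 U) (@sec_addN U).

Definition sec_res (U V : opens X) (h : V `<=` U) (s : sec U) : sec V.
Proof.
by exists (fun p hp => s p (h p hp)) => p q hp hq hpq; exact: sec_compat.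
Defined.

Lemma sec_res_additive (U V : opens X) (h : V `<=` U) : zmod_morphism (sec_res h).
Proof. by move=> s t; apply: sec_ext. Qed.
HB.instance Definition _ (U V : opens X) (h : V `<=` U) :=
  GRing.isZmodMorphism.Build _ _ (sec_res h) (sec_res_additive h).

Lemma sec_sheaf : is_sheaf (fun U V (h : V `<=` U) => sec_res h : sec U -> sec V).
Proof.
split=> [U h s|U V W h h' h'' s|U I V hV s UE sV].
- by apply: sec_ext => p hp /=; apply: sec_irr.
- by apply: sec_ext => p hp /=; apply: sec_irr.
have cov p (hp : oset U p) : exists i, oset (V i) p.
  by move: hp; rewrite UE => -[i _ hi]; exists i.
(* The member of the cover containing [p] is picked arbitrarily; [tE] shows, by comparing on the
   minimal open of [p], that the value does not depend on it. *)
pose t p hp : P p := s (sval (cid (cov p hp))) p (svalP (cid (cov p hp))).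
have tE i p (hi : oset (V i) p) (hp : oset U p) : t p hp = s i p hi.
  rewrite /t; case: cid => j hj /=.
  have /(congr1 (fun u : sec (minopen p) => u p (@minopen_mem _ p))) :=
    sV j i (minopen p) (minopen_sub hj) (minopen_sub hi).
  move=> /= e; rewrite -(sec_irr (s i) (minopen_sub hi (@minopen_mem _ p)) hi) -e.
  exact: sec_irr.
have ct p q (hp : oset U p) (hq : oset U q) (h : spec p q) :
    pmap P h (t p hp) = t q hq.
  have [i hi] := cov p hp; have hiq : oset (V i) q := minopen_sub hi (h _ (@minopen_mem _ q)).
  by rewrite (tE i p hi) (tE i q hiq); exact: sec_compat.
exists (Sec ct); split=> [i|u uP]; apply: sec_ext => p hp /=; first exact: tE.
by have [i hi] := cov p hp; rewrite (tE i p hi) -uP /=; apply: sec_irr.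
Qed.

Definition shf : absheaf X :=
  @AbSheaf X (fun U => sec U) (fun U V h => sec_res h) sec_sheaf.

Definition stalk_val p (s : sec (minopen p)) : P p := s p (@minopen_mem _ p).

Definition stalk_sec p (x : P p) : sec (minopen p).
Proof.
exists (fun q hq => pmap P (minopen_sub hq : spec p q) x) => q r hq hr h.
exact: pmap_comp.
Defined.

Lemma stalk_sec_additive p : zmod_morphism (@stalk_sec p).
Proof. by move=> x y; apply: sec_ext => q hq; exact: raddfB. Qed.
HB.instance Definition _ p :=
  GRing.isZmodMorphism.Build _ _ (@stalk_sec p) (@stalk_sec_additive p).

Lemma stalk_val_additive p : zmod_morphism (@stalk_val p).
Proof. by []. Qed.
HB.instance Definition _ p :=
  GRing.isZmodMorphism.Build _ _ (@stalk_val p) (@stalk_val_additive p).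

Lemma stalk_secK p (x : P p) : stalk_val (stalk_sec x) = x.
Proof. exact: pmap_id. Qed.

Lemma stalk_valK p (s : sec (minopen p)) : stalk_sec (stalk_val s) = s.
Proof. by apply: sec_ext => q hq; exact: sec_compat. Qed.

Lemma stalk_val_inj p : injective (@stalk_val p).
Proof. exact: can_inj (@stalk_valK p). Qed.

Lemma stalk_sec_res p q (h : spec p q) (x : P p) :
  sec_res h (stalk_sec x) = stalk_sec (pmap P h x).
Proof. by apply: sec_ext => r hr; exact/esym/pmap_comp. Qed.
End SheafOfPsh.

Section ShfMaps.
Variable X : finTopologicalType.

Section ToShf.
Variables (F : absheaf X) (P : psh X) (f : pnat (psh_of F) P).

Definition to_shf_fun (U : opens X) (s : F U) : shf P U.
Proof.
exists (fun p hp => f p (ares F (minopen_sub hp) s)) => p q hp hq h.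
by rewrite -pnfE; congr (f q _); exact: ares_comp.
Defined.

Lemma to_shf_additive (U : opens X) : zmod_morphism (@to_shf_fun U).
Proof. by move=> s t; apply: sec_ext => p hp; rewrite /= !raddfB. Qed.
HB.instance Definition _ (U : opens X) :=
  GRing.isZmodMorphism.Build _ _ (@to_shf_fun U) (@to_shf_additive U).

Lemma to_shf_res (U V : opens X) (h : V `<=` U) (s : F U) :
  to_shf_fun (ares F h s) = ares (shf P) h (to_shf_fun s).
Proof. by apply: sec_ext => p hp; congr (f p _); exact: ares_comp. Qed.

Definition to_shf : ab_hom F (shf P) := @AbHom X F (shf P) (fun U => @to_shf_fun U) to_shf_res.

Lemma to_shf_stalk p (x : F (minopen p)) : to_shf (minopen p) x = stalk_sec (f p x).
Proof. by apply: sec_ext => q hq; exact: pnfE. Qed.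

Lemma to_shf_inj : (forall p, injective (f p)) -> forall U, injective (to_shf U).
Proof.
move=> fi U s t st; apply: (sheaf_sep (ares_sheaf F)) => p hp; apply: fi.
exact: (congr1 (fun u : sec P U => u p hp) st).
Qed.
End ToShf.

Section ShfMap.
Variables (P Q : psh X) (f : pnat P Q).

Definition shf_map_fun (U : opens X) (s : shf P U) : shf Q U.
Proof.
exists (fun p hp => f p (s p hp)) => p q hp hq h.
by rewrite -pnfE (sec_compat s hp hq).
Defined.

Lemma shf_map_additive (U : opens X) : zmod_morphism (@shf_map_fun U).
Proof. by move=> s t; apply: sec_ext => p hp; rewrite /= raddfB. Qed.
HB.instance Definition _ (U : opens X) :=
  GRing.isZmodMorphism.Build _ _ (@shf_map_fun U) (@shf_map_additive U).

Lemma shf_map_res (U V : opens X) (h : V `<=` U) (s : shf P U) :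
  shf_map_fun (ares (shf P) h s) = ares (shf Q) h (shf_map_fun s).
Proof. by apply: sec_ext. Qed.

Definition shf_map : ab_hom (shf P) (shf Q) :=
  @AbHom X (shf P) (shf Q) (fun U => @shf_map_fun U) shf_map_res.

Lemma shf_map_stalk p (s : shf P (minopen p)) :
  stalk_val (shf_map (minopen p) s) = f p (stalk_val s).
Proof. by []. Qed.
End ShfMap.
End ShfMaps.

(** * Injective sheaves and relative injectivity *)

Section InjectiveSheaves.
Variable X : finTopologicalType.

(** A morphism to this sheaf amounts to one group map per representative, so the problem splits into
    extensions to [J y] along the stalk maps of [i]. *)
Lemma pprod_injective_sheaf (J : X -> zmodType) :
  (forall y, injective_group (J y)) -> injective_sheaf (shf (pprod J)).
Proof.
move=> injJ F G i f inj_i.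
have ex y : exists g : {additive G (minopen y) -> J y},
    forall (r : is_rep y) s,
      g (i (minopen y) s) = f (minopen y) s y (@minopen_mem _ y) y r (spec_refl y).
  have [r|nr] := pselect (is_rep y); last first.
    by have [g _] := injJ y _ _ (i (minopen y)) \0 (inj_i _); exists g => r; case: nr.
  pose fy (s : F (minopen y)) : J y :=
    f (minopen y) s y (@minopen_mem _ y) y r (spec_refl y).
  have fy_additive : zmod_morphism fy by move=> s t; rewrite /fy raddfB.
  have [g gP] := injJ y _ _ (i (minopen y)) (additive_of fy_additive) (inj_i _).
  by exists g => r' s; rewrite gP (Prop_irrelevance r' r).
have [g gP] := dep_choice ex.
exists (to_shf (to_pprod (F := psh_of G) g)) => U s.
apply: sec_ext => p hp; apply: pprod_ext => y r h /=.
rewrite /to_pprod_fun /= -!ahom_res gP.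
set V := minopen p; rewrite (ares_comp _ _ (subset_trans h (minopen_sub hp))).
rewrite ahom_res /= (sec_irr _ _ (minopen_sub hp (h _ (@minopen_mem _ y)))).
have hy : oset U y := minopen_sub hp (h _ (@minopen_mem _ y)).
rewrite (sec_irr _ _ hy) -(sec_compat (f U s) hp hy h) /=.
by congr (f U s p hp y r _); exact: Prop_irrelevance.
Qed.

(** The identity of [I] extends along the embedding of [I] into the sheaf of its Godement functor;
    on stalks this extension is the retraction. *)
Lemma injective_sheaf_relinj (I : absheaf X) : injective_sheaf I -> relinj (psh_of I).
Proof.
move=> injI; pose P := psh_of I.
have [|g gP] := injI I (shf (gode P)) (to_shf (gunit P))
    (@AbHom X I I (fun U => idfun) (fun U V h s => erefl)).
  by apply: to_shf_inj => p; exact: gunit_inj.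
pose r p := (g (minopen p) \o @stalk_sec X (gode P) p : {additive gode P p -> P p}).
have rE p q (h : spec p q) x : r q (pmap (gode P) h x) = pmap P h (r p x).
  by rewrite /r /= -stalk_sec_res -[sec_res _ _]/(ares (shf (gode P)) h _) ahom_res.
exists (PNat rE) => p x.
by rewrite -[LHS]/(g (minopen p) (stalk_sec (gunit P p x))) -to_shf_stalk gP.
Qed.

(** Dimension shifting: [d 0] embeds [pcoker a] into [E 1], so the tail of the resolution resolves
    [pcoker a]. As [E 0] has no higher cohomology, H^(n+2)(F) vanishes exactly when H^(n+1) of
    [pcoker a] does. *)
Lemma hvanish_resolution n (F : psh X) (E : nat -> psh X) (a : pnat F (E 0))
    (d : forall k, pnat (E k) (E k.+1)) :
  (forall p, injective (a p)) ->
  (forall p y, d 0 p y = 0 <-> exists x, a p x = y) ->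
  (forall k p y, d k.+1 p y = 0 <-> exists x, d k p x = y) ->
  (forall k, relinj (E k)) ->
  hvanish n F <->
  forall s : (forall p, E n.+1 p), compat s -> (forall p, d n.+1 p (s p) = 0) ->
    exists2 t, compat t & forall p, d n p (t p) = s p.
Proof.
elim: n F E a d => [|n IHn] F E a d a_inj ex0 exS rE.
all: have da p x : d 0 p (a p x) = 0 by apply/ex0; exists x.
all: pose a' := pdesc da.
all: have a'E p x : a' p (pcoker_proj a p x) = d 0 p x by exact: pdescE.
all: have a'_inj p : injective (a' p).
1,3: apply: raddf_inj => z; have [x <-] := pcoker_proj_surj z; rewrite a'E.
1,2: by move=> /ex0 ?; exact/pcoker_proj_eq0.
all: have ex1 p y : d 1 p y = 0 <-> exists z, a' p z = y.
1,3: split=> [/exS[x <-]|[z <-]]; first by exists (pcoker_proj a p x).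
1,2: by have [x <-] := pcoker_proj_surj z; rewrite a'E; apply/exS; exists x.
all: have S := pcoker_ses a_inj.
- split=> [vF s cs ds|H].
    have [z zP] := dep_choice (fun p => (ex1 p (s p)).1 (ds p)).
    have cz : compat z by apply: (compat_inj a'_inj) => p q h; rewrite !zP.
    have [t ct tP] := ses_gsurj S vF cz.
    by exists t => // p; rewrite -zP -tP a'E.
  apply: (hvanish0_sub S); first exact: relinj_hvanish0.
  move=> c cc; have [|p|t ct tP] := H (fun p => a' p (c p)).
  - exact: compat_pnat.
  - by apply/ex1; exists (c p).
  - by exists t => // p; apply: a'_inj; rewrite a'E.
- rewrite -(IHn _ (fun k => E k.+1) a' (fun k => d k.+1)) //.
  have eS : exses F (E 0%N) (pcoker a) by exists a, (pcoker_proj a).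
  split=> v; first exact: hvanish_quo eS (relinj_hvanish (rE 0%N)) v.
  exact: hvanish_sub eS v (relinj_hvanish (rE 0%N)).
Qed.

(** * Comparison with injective resolutions *)

Definition inj_psh (F : psh X) : psh X := pprod (fun y => inj_hull (F y)).
Definition to_inj_psh (F : psh X) : pnat F (inj_psh F) :=
  to_pprod (fun y => @to_inj_hull (F y)).
Definition cosyzygy (F : psh X) : psh X := pcoker (to_inj_psh F).

Lemma to_inj_psh_inj F p : injective (to_inj_psh F p).
Proof. by apply: to_pprod_inj => y; exact: to_inj_hull_inj. Qed.

Section CanonicalResolution.
Variable F : absheaf X.

Definition cres_psh n : psh X := inj_psh (iter n cosyzygy (psh_of F)).
(** Projection onto the next cosyzygy followed by its embedding, so that the kernel is the [n]-th
    cosyzygy. *)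
Definition cres_diff n : pnat (cres_psh n) (cres_psh n.+1) :=
  pcomp (to_inj_psh _) (pcoker_proj (to_inj_psh (iter n cosyzygy (psh_of F)))).

Lemma cres_diff_eq0 n p x : cres_diff n p x = 0 <->
  exists y, to_inj_psh (iter n cosyzygy (psh_of F)) p y = x.
Proof.
rewrite -pcoker_proj_eq0; split=> [e|e].
  by apply: (@to_inj_psh_inj _ p); rewrite raddf0.
by rewrite -[LHS]/(to_inj_psh _ p (pcoker_proj _ p x)) e raddf0.
Qed.

Lemma cres_exact n p x : cres_diff n.+1 p x = 0 <-> exists y, cres_diff n p y = x.
Proof.
rewrite cres_diff_eq0; split=> [[y <-]|[y <-]].
  by have [z <-] := pcoker_proj_surj y; exists z.
by exists (pcoker_proj _ p y).
Qed.

Definition cres : injective_resolution F.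
Proof.
exists (fun n => shf (cres_psh n)) (to_shf (to_inj_psh (psh_of F)))
  (fun n => shf_map (cres_diff n)) => [n|p|p s|n p s].
- by apply: pprod_injective_sheaf => y; exact: inj_hull_injective.
- apply: to_shf_inj; exact: to_inj_psh_inj.
  split=> [e|[t <-]].
    have /cres_diff_eq0[y yP] : cres_diff 0 p (stalk_val s) = 0.
      by rewrite -shf_map_stalk e raddf0.
    by exists y; rewrite to_shf_stalk yP stalk_valK.
  apply: stalk_val_inj; rewrite shf_map_stalk raddf0 to_shf_stalk stalk_secK.
  by apply/cres_diff_eq0; exists t.
- split=> [e|[t <-]].
    have /cres_exact[y yP] : cres_diff n.+1 p (stalk_val s) = 0.
      by rewrite -shf_map_stalk e raddf0.
    exists (stalk_sec y); apply: stalk_val_inj.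
    by rewrite shf_map_stalk stalk_secK.
  apply: stalk_val_inj; rewrite !shf_map_stalk raddf0.
  by apply/cres_exact; exists (stalk_val t).
Qed.
End CanonicalResolution.

(** Since [E] is arbitrary, this contains the independence of the choice of injective resolution. *)
Lemma resolution_hvanish n (F : absheaf X) (E : injective_resolution F) :
  hvanish n (psh_of F) <->
  forall s : E n.+1 (full X), idiff E n.+1 (full X) s = 0 ->
    exists t, idiff E n (full X) t = s.
Proof.
rewrite (@hvanish_resolution n (psh_of F) (fun k => psh_of (E k)) (psh_map (iaug E))
  (fun k => psh_map (idiff E k))).
- split=> [H s ds|H s cs ds].
    have [p|t ct tP] := H _ (compat_global s).
    + by rewrite /= ahom_res ds raddf0.
    + have [u uP] := psh_of_global ct; exists u; apply: global_sep => p.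
      by rewrite -ahom_res uP -tP.
  have [u uP] := psh_of_global cs.
  have [|t tP] := H u.
    by apply: global_sep => p; rewrite -ahom_res uP raddf0; exact: ds.
  exists (fun p => ares (E n) (@minopen_full X p) t) => [|p]; first exact: compat_global.
  by rewrite /= ahom_res tP uP.
- exact: iaug_injective.
- exact: ires_exact0.
- exact: ires_exactS.
- by move=> k; apply: injective_sheaf_relinj; exact: ires_injective.
Qed.

Lemma cohomologyS_vanishesP n (F : absheaf X) :
  cohomologyS_vanishes n F <-> hvanish n (psh_of F).
Proof.
split=> [[E /resolution_hvanish //]|v]; exists (cres F).
exact/resolution_hvanish.
Qed.
End InjectiveSheaves.

(** * Free modules and flat base change *)

Section FreeModules.
Variables (R : comPzRingType) (I : Type).
Implicit Types f g : free_module R I.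

Lemma free_funD f g i : (f + g) i = f i + g i.
Proof. by []. Qed.
Lemma free_funZ a f i : (a *: f) i = a * f i.
Proof. by []. Qed.

Lemma free_single_subproof (i : I) (a : R) :
  fin_supp (fun j => if pselect (j = i) is left _ then a : R^o else 0).
Proof.
apply/asboolP; apply: (sub_finite_set _ (finite_set1 i)) => j /=.
by case: pselect => // _; rewrite eqxx.
Qed.

Definition free_single i a : free_module R I := FreeModule (free_single_subproof i a).
Definition free_basis i := free_single i 1.

Lemma free_singleE i a j :
  free_single i a j = if pselect (j = i) is left _ then a : R^o else 0.
Proof. by []. Qed.

Lemma free_singleD i a b : free_single i (a + b) = free_single i a + free_single i b.
Proof.
by apply: free_ext => j; rewrite free_funD !free_singleE; case: pselect; rewrite ?addr0.
Qed.

Lemma free_singleZ i a b : free_single i (a * b) = a *: free_single i b.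
Proof.
by apply: free_ext => j; rewrite free_funZ !free_singleE; case: pselect; rewrite ?mulr0.
Qed.

Lemma free_single_basis i a : free_single i a = a *: free_basis i.
Proof. by rewrite -free_singleZ mulr1. Qed.

(** The index type carries no equality test, so supports are lists over [{classic I}]. *)
Definition free_supp f : seq {classic I} :=
  fset_set ([set i | f i != 0] : set {classic I}).

Lemma free_supp_uniq f : uniq (free_supp f).
Proof. exact: fset_uniq. Qed.

Lemma mem_free_supp f i : f i != 0 -> (i : {classic I}) \in free_supp f.
Proof.
move=> fi; have /asboolP fin := free_finP f.
by rewrite /free_supp in_fset_set ?inE.
Qed.

Section Fsum.
Variables (V : zmodType) (F : I -> R -> V).
Hypothesis FD : forall i, {morph F i : a b / a + b}.

(** Only additivity of the [F i] is asked, because some targets will be tensor products over a ring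
    other than the coefficient ring. *)
Definition fsum f : V := \sum_(i <- free_supp f) F i (f i).

Lemma F0 i : F i 0 = 0.
Proof. by apply: (@addrI _ (F i 0)); rewrite -FD !addr0. Qed.

Lemma fsumE f (t : seq {classic I}) : uniq t -> (forall i, f i != 0 -> i \in t) ->
  fsum f = \sum_(i <- t) F i (f i).
Proof.
move=> ut st.
have cond (s : seq {classic I}) : uniq s -> (forall i, f i != 0 -> i \in s) ->
    \sum_(i <- s) F i (f i) = \sum_(i <- [seq i <- s | f i != 0]) F i (f i).
  move=> _ _; rewrite big_filter [RHS]big_mkcond /=; apply: eq_bigr => i _.
  by case: eqP => //= ->; rewrite F0.
rewrite /fsum (cond _ (free_supp_uniq f) (@mem_free_supp f)) (cond _ ut st).
apply: (@perm_big _ _ _ {classic I}); apply: uniq_perm;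
  rewrite ?filter_uniq ?free_supp_uniq // => i.
rewrite !mem_filter; case: (boolP (f i != 0)) => //= fi.
by rewrite mem_free_supp // st.
Qed.

Lemma fsumD f g : fsum (f + g) = fsum f + fsum g.
Proof.
pose t := undup (free_supp f ++ free_supp g).
have ft i : f i != 0 -> (i : {classic I}) \in t.
  by move=> fi; rewrite mem_undup mem_cat mem_free_supp.
have gt i : g i != 0 -> (i : {classic I}) \in t.
  by move=> gi; rewrite mem_undup mem_cat (mem_free_supp gi) orbT.
rewrite !(@fsumE _ t) ?undup_uniq // -?big_split /=.
  by apply: eq_bigr => i _; exact: FD.
move=> i; rewrite -[X in X != 0]/(f i + g i); case: (eqVneq (f i) 0) => [->|/ft //].
by rewrite add0r; exact: gt.
Qed.

Lemma fsum_single i a : fsum (free_single i a) = F i a.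
Proof.
rewrite (@fsumE _ [:: i : {classic I}]) ?big_seq1 //.
  by rewrite free_singleE; case: pselect.
move=> j; rewrite free_singleE; case: pselect => [-> _|_].
  exact: (@mem_head {classic I}).
by rewrite eqxx.
Qed.

Lemma fsum_zmod_morphism : zmod_morphism fsum.
Proof. by move=> f g; apply: (@addIr _ (fsum g)); rewrite -fsumD !subrK. Qed.
End Fsum.

Lemma free_decomp f : f = \sum_(i <- free_supp f) free_single i (f i).
Proof.
apply: free_ext => i.
have ev_additive : zmod_morphism (fun g : free_module R I => g i : R) by [].
rewrite -[RHS]/(additive_of ev_additive _) raddf_sum /=.
have [fi|fi] := eqVneq (f i) 0.
  by rewrite fi big1 // => j _; case: pselect => // ij; rewrite -ij fi.
rewrite (bigD1_seq (i : {classic I})) ?free_supp_uniq ?mem_free_supp //=.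
rewrite big1 ?addr0 => [|j /eqP ji]; first by case: pselect.
by case: pselect => // ij; case: ji.
Qed.

Lemma additive_free_ext (V : zmodType) (g g' : {additive free_module R I -> V}) :
  (forall i a, g (free_single i a) = g' (free_single i a)) -> g =1 g'.
Proof.
move=> gg' f; rewrite (free_decomp f) !raddf_sum.
by apply: eq_bigr => i _.
Qed.

Section Lincomb.
Variables (V : lmodType R) (s : I -> V).

Definition lincomb : free_module R I -> V := fsum (fun i a => a *: s i).

Lemma lincombD i : {morph (fun a => a *: s i) : a b / a + b}.
Proof. by move=> a b; exact: scalerDl. Qed.

Lemma lincomb_additive : zmod_morphism lincomb.
Proof. exact/fsum_zmod_morphism/lincombD. Qed.
HB.instance Definition _ :=
  GRing.isZmodMorphism.Build _ _ lincomb lincomb_additive.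

Lemma lincomb_single i a : lincomb (free_single i a) = a *: s i.
Proof. exact: (fsum_single lincombD). Qed.

Lemma lincomb_scalable : scalable lincomb.
Proof.
move=> a; apply: (additive_free_ext (g := (lincomb \o *:%R a : {additive _ -> _}))
  (g' := ( *:%R a \o lincomb : {additive _ -> _}))) => i b.
by rewrite /= -free_singleZ !lincomb_single scalerA.
Qed.
HB.instance Definition _ :=
  GRing.isScalable.Build R _ _ *:%R lincomb lincomb_scalable.

Lemma lincomb_basis i : lincomb (free_basis i) = s i.
Proof. by rewrite lincomb_single scale1r. Qed.
End Lincomb.

Lemma linear_free_ext (V : lmodType R) (g g' : {linear free_module R I -> V}) :
  (forall i, g (free_basis i) = g' (free_basis i)) -> g =1 g'.
Proof.
move=> gg'; apply: additive_free_ext => i a.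
by rewrite free_single_basis -[LHS]/(g (a *: _)) -[RHS]/(g' (a *: _)) !linearZ gg'.
Qed.

Lemma linear_lincomb (V W : lmodType R) (g : {linear V -> W}) (s : I -> V) f :
  g (lincomb s f) = lincomb (fun i => g (s i)) f.
Proof.
apply: (linear_free_ext (g := (g \o lincomb s : {linear _ -> _}))) => i /=.
by rewrite !lincomb_basis.
Qed.

Lemma lincomb_basis_id f : lincomb free_basis f = f.
Proof. by apply: (linear_free_ext (g' := idfun)) => i; exact: lincomb_basis. Qed.
End FreeModules.

Lemma tensor_lift_additive (R : comPzRingType) (M N : lmodType R) (P : zmodType)
    (f : M -> N -> P) :
  (forall m m' n, f (m + m') n = f m n + f m' n) ->
  (forall m n n', f m (n + n') = f m n + f m n') ->
  (forall a m n, f (a *: m) n = f m (a *: n)) ->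
  zmod_morphism (tensor_lift f).
Proof.
move=> fDl fDr fZ x y.
suff liftD u v : tensor_lift f (u + v) = tensor_lift f u + tensor_lift f v.
  by apply: (@addIr _ (tensor_lift f y)); rewrite -liftD !subrK.
rewrite -(tensor_reprK u) -(tensor_reprK v) [X in tensor_lift f X]tensor_add_class.
by rewrite !tensor_liftE // big_cat.
Qed.

Section BaseChange.
Variables (R S : comPzRingType) (sigma : {rmorphism R -> S}).

Lemma free_map_subproof (I : Type) (f : free_module R I) :
  fin_supp (fun i => sigma (f i) : S^o).
Proof.
apply/asboolP; have /asboolP := free_finP f; apply: sub_finite_set => i /=.
by apply: contra_neq => ->; exact: rmorph0.
Qed.

Definition free_map (I : Type) (f : free_module R I) : free_module S I :=
  FreeModule (free_map_subproof f).

Lemma free_map_additive (I : Type) : zmod_morphism (@free_map I).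
Proof. by move=> f g; apply: free_ext => i; exact: (rmorphB sigma). Qed.
HB.instance Definition _ (I : Type) :=
  GRing.isZmodMorphism.Build _ _ (@free_map I) (@free_map_additive I).

Lemma free_mapD (I : Type) (f g : free_module R I) :
  free_map (f + g) = free_map f + free_map g.
Proof. exact: (raddfD (@free_map I)). Qed.

Lemma free_mapZ (I : Type) a (f : free_module R I) :
  free_map (a *: f) = sigma a *: free_map f.
Proof. by apply: free_ext => i; exact: (rmorphM sigma). Qed.

Lemma free_map_single (I : Type) (i : I) a :
  free_map (free_single i a) = free_single i (sigma a).
Proof.
apply: free_ext => j /=.
by case: pselect => // _; exact: rmorph0.
Qed.

Lemma free_map_basis (I : Type) (i : I) : free_map (free_basis R i) = free_basis S i.
Proof. by rewrite free_map_single rmorph1. Qed.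

Lemma semilinear_lincomb (I : Type) (V : lmodType R) (W : lmodType S)
    (g : {additive V -> W}) (gZ : forall a v, g (a *: v) = sigma a *: g v)
    (s : I -> V) f : g (lincomb s f) = lincomb (fun i => g (s i)) (free_map f).
Proof.
apply: (additive_free_ext (g := (g \o lincomb s : {additive _ -> _}))
  (g' := (lincomb (fun i => g (s i)) \o @free_map I : {additive _ -> _}))) => i a.
by rewrite /= free_map_single !lincomb_single gZ.
Qed.

Section FlatRelations.
Variables (I : Type) (K : lmodType R) (i : {linear K -> free_module R I}).
Hypotheses (flat : flat_morphism sigma) (inj_i : injective i).

Let N : lmodType R := restr_scalars sigma.
Let theta : free_module S I -> tensor (free_module R I) N :=
  fsum (fun j a => pure_tensor (free_basis R j) (a : N)).
Let tau : free_module S K -> tensor K N := fsum (fun k a => pure_tensor k (a : N)).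

Let theta_additive : zmod_morphism theta.
Proof. by apply: fsum_zmod_morphism => j a b; exact: pure_tensorDr. Qed.

Let tau_additive : zmod_morphism tau.
Proof. by apply: fsum_zmod_morphism => j a b; exact: pure_tensorDr. Qed.

(* theta is the isomorphism S^(I) -> R^(I) (x)_R S. *)
Let pure_theta (f : free_module R I) (a : S) :
  pure_tensor f (a : N) = theta (a *: free_map f).
Proof.
have lB : zmod_morphism (fun f : free_module R I => pure_tensor f (a : N)).
  by move=> g h; apply: (@addIr _ (pure_tensor h (a : N))); rewrite -pure_tensorDl !subrK.
have rB : zmod_morphism (fun f : free_module R I => theta (a *: free_map f)).
  by move=> g h; rewrite raddfB scalerBr; exact: theta_additive.
apply: (additive_free_ext (g := additive_of lB) (g' := additive_of rB)) => j c.
rewrite !additive_ofE free_map_single -free_singleZ /theta fsum_single; last first.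
  by move=> k x y; exact: pure_tensorDr.
rewrite free_single_basis pure_tensorZ; congr pure_tensor.
exact: mulrC.
Qed.

Let base_change_relations (b : free_module S K) :
  tensor_map (N := N) i (tau b) = theta (lincomb (fun k => free_map (i k)) b).
Proof.
have lB : zmod_morphism (fun b => tensor_map (N := N) i (tau b)).
  move=> x y; rewrite tau_additive; apply: tensor_lift_additive => [m m' n|m n n'|a m n].
  - by rewrite raddfD pure_tensorDl.
  - exact: pure_tensorDr.
  - by rewrite linearZ pure_tensorZ.
have rB : zmod_morphism (fun b => theta (lincomb (fun k => free_map (i k)) b)).
  by move=> x y; rewrite raddfB; exact: theta_additive.
apply: (additive_free_ext (g := additive_of lB) (g' := additive_of rB)) => k a.
rewrite !additive_ofE lincomb_single /tau fsum_single; last first.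
  by move=> k' x y; exact: pure_tensorDr.
by rewrite tensor_map_pure pure_theta.
Qed.

(* The relation b defines an element of K (x)_R S whose image in R^(I) (x)_R S vanishes;
   by flatness it already vanishes in K (x)_R S, hence modulo R-linear relations. *)
Lemma flat_relations (b : free_module S K) :
  lincomb (fun k => free_map (i k)) b = 0 ->
  exists c : free_module S (lker (lincomb (@id K))),
    lincomb (fun l : lker (lincomb (@id K)) => free_map (lker_val l)) c = b.
Proof.
move=> b0; set L := lker _; pose g := lincomb (fun l : L => free_map (lker_val l)).
have tau0 : tau b = 0.
  apply: (flat inj_i); rewrite base_change_relations b0.
  have := base_change_relations 0; rewrite raddf0 (zmod_morphism0 theta_additive).
  by rewrite (zmod_morphism0 tau_additive).
(* The map induced by [xi] on K (x)_R S is a left inverse of [tau] modulo the image of [g]. The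
   defects of additivity in [k] and of balancedness are multiples of base-changed [R]-linear
   relations, which [relP] kills. *)
pose xi (k : K) (a : N) : coker g := coker_class g (free_single k (a : S)).
have relP (l : free_module R K) (lP : lincomb (@id K) l = 0) (a : S) :
    coker_class g (a *: free_map l) = 0.
  apply/coker_class_eq0; exists (free_single (mklker lP) a).
  exact: (lincomb_single (fun l : L => free_map (lker_val l))).
have clsP x y : coker_class g (x - y) = 0 -> coker_class g x = coker_class g y.
  by rewrite raddfB => /eqP; rewrite subr_eq0 => /eqP.
have xiDl m m' n : xi (m + m') n = xi m n + xi m' n.
  rewrite /xi -[RHS](raddfD (coker_class g)); apply: clsP.
  rewrite (_ : _ - _ = (n : S) *: free_map
      (free_basis R (m + m') - (free_basis R m + free_basis R m'))); last first.
    rewrite !(free_single_basis _ (n : S)) -scalerDr -scalerBr.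
    by congr (_ *: _); rewrite free_map_additive free_mapD !free_map_basis.
  by apply: relP; rewrite raddfB raddfD /= !lincomb_basis subrr.
have xiDr m n n' : xi m (n + n') = xi m n + xi m n'.
  by rewrite /xi -raddfD -free_singleD.
have xiZ a m n : xi (a *: m) n = xi m (a *: n).
  apply: clsP.
  rewrite (_ : _ - _ = (n : S) *: free_map
      (free_basis R (a *: m) - a *: free_basis R m)); last first.
    rewrite free_map_additive free_mapZ scalerBr !free_map_basis scalerA.
    by rewrite -!free_single_basis [_ * sigma a]mulrC.
  by apply: relP; rewrite linearB linearZ /= !lincomb_basis subrr.
have xi_additive := tensor_lift_additive xiDl xiDr xiZ.
have xi_tau : tensor_lift xi (tau b) = coker_class g b.
  have lB : zmod_morphism (fun b => tensor_lift xi (tau b)).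
    by move=> x y; rewrite tau_additive xi_additive.
  apply: (additive_free_ext (g := additive_of lB) (g' := coker_class g)) => k a.
  rewrite additive_ofE /tau fsum_single ?tensor_lift_pure //.
  by move=> k' x y; exact: pure_tensorDr.
have : coker_class g b = 0.
  by rewrite -xi_tau tau0 (zmod_morphism0 xi_additive).
by move=> /coker_class_eq0.
Qed.
End FlatRelations.
End BaseChange.

Lemma lincombB (R : comPzRingType) (I : Type) (V : lmodType R) (s t : I -> V) f :
  lincomb (fun i => s i - t i) f = lincomb s f - lincomb t f.
Proof. by rewrite /lincomb /fsum -sumrB; apply: eq_bigr => i _; exact: scalerBr. Qed.

Lemma lincomb0 (R : comPzRingType) (I : Type) (V : lmodType R) (s : I -> V) f :
  (forall i, s i = 0) -> lincomb s f = 0.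
Proof. by move=> s0; rewrite /lincomb /fsum big1 // => i _; rewrite s0 scaler0. Qed.

Lemma eq_lincomb (R : comPzRingType) (I : Type) (V : lmodType R) (s t : I -> V) f :
  (forall i, s i = t i) -> lincomb s f = lincomb t f.
Proof. by move=> st; congr (lincomb _ f); exact: funext. Qed.

Section KernelSpanned.
Variables (R S : comPzRingType) (sigma : {rmorphism R -> S}) (I I' J : Type).
Variables (M : lmodType R) (N : lmodType S) (rho : {additive M -> N}).
Variables (psi : {linear free_module R I -> M}) (psiS : {linear free_module S I -> N}).
Variables (psi' : {linear free_module R I' -> M}) (psiS' : {linear free_module S I' -> N}).
Variables (phi : {linear free_module R J -> free_module R I'})
  (phiS : {linear free_module S J -> free_module S I'}).
Hypotheses (psiE : forall f, psiS (free_map sigma f) = rho (psi f))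
  (psiE' : forall f, psiS' (free_map sigma f) = rho (psi' f))
  (phiE : forall f, phiS (free_map sigma f) = free_map sigma (phi f)).
Hypotheses (psi_surj : forall m, exists f, psi f = m)
  (psi_surj' : forall m, exists f, psi' f = m)
  (psi_phi : forall f, psi' (phi f) = 0)
  (exact' : forall f, psiS' f = 0 -> exists g, phiS g = f).

(* Compare the presentation (phi, psi') with psi by lifting each through the other:
   the kernel of psi is spanned by the errors of the lifts and by the lifted relations,
   and both families are already defined over R. *)
Lemma kernel_spanned (k : free_module S I) : psiS k = 0 ->
  exists b : free_module S (lker psi),
    lincomb (fun x : lker psi => free_map sigma (lker_val x)) b = k.
Proof.
move=> k0.
have [w wP] := choice (fun i => psi_surj' (psi (free_basis R i))).
have [h hP] := choice (fun j => psi_surj (psi' (free_basis R j))).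
pose H : {linear _ -> _} := lincomb h.
pose HS : {linear _ -> _} := lincomb (fun j => free_map sigma (h j)).
have psiH f : psi (H f) = psi' f.
  by apply: (linear_free_ext (g := (psi \o H : {linear _ -> _}))) => j /=;
    rewrite /H lincomb_basis hP.
have HE f : free_map sigma (H f) = HS (free_map sigma f).
  exact: (semilinear_lincomb (g := @free_map _ _ sigma I) (fun a v => free_mapZ sigma a v)).
have xP i : psi (free_basis R i - H (w i)) = 0 by rewrite linearB /= psiH wP subrr.
have yP j : psi (H (phi (free_basis R j))) = 0 by rewrite psiH psi_phi.
pose W : {linear _ -> _} := lincomb (fun i => free_map sigma (w i)).
have psiW f : psiS' (W f) = psiS f.
  apply: (linear_free_ext (g := (psiS' \o W : {linear _ -> _}))) => i /=.
  by rewrite /W lincomb_basis psiE' wP -psiE free_map_basis.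
have [z zP] := exact' (etrans (psiW k) k0).
(* The first term contributes k - HS (W k). Since [W k] is killed by [psiS'], it equals [phiS z],
   and the second term restores HS (W k). *)
exists (lincomb (fun i => free_basis S (mklker (xP i))) k
  + lincomb (fun j => free_basis S (mklker (yP j))) z).
rewrite raddfD /= !linear_lincomb.
have -> : lincomb (fun i => lincomb (fun x : lker psi => free_map sigma (lker_val x))
    (free_basis S (mklker (xP i)))) k = k - HS (W k).
  rewrite -[X in _ = X - _]lincomb_basis_id /W (linear_lincomb HS) -lincombB.
  apply: eq_lincomb => i; rewrite lincomb_basis /=.
  by rewrite free_map_additive free_map_basis HE.
have -> : lincomb (fun j => lincomb (fun x : lker psi => free_map sigma (lker_val x))
    (free_basis S (mklker (yP j)))) z = HS (W k).
  rewrite -[in RHS]zP -[in RHS](lincomb_basis_id z) (linear_lincomb phiS) (linear_lincomb HS).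
  apply: eq_lincomb => j; rewrite lincomb_basis /=.
  by rewrite HE -phiE free_map_basis.
by rewrite subrK.
Qed.
End KernelSpanned.

(** * Modules over a ringed finite space *)

Section OModules.
Variables (X : finTopologicalType) (O : ringsheaf X).
Implicit Types M N T : omodule O.

Lemma mres_id M (U : opens X) (h : U `<=` U) (s : M U) : mres M h s = s.
Proof. by case: (mres_sheaf M) => + _ _; apply. Qed.

Lemma mres_comp M (U V W : opens X) (h : V `<=` U) (h' : W `<=` V) (h'' : W `<=` U)
  (s : M U) : mres M h' (mres M h s) = mres M h'' s.
Proof. by case: (mres_sheaf M) => _ + _; apply. Qed.

Lemma rres_comp (U V W : opens X) (h : V `<=` U) (h' : W `<=` V) (h'' : W `<=` U)
  (a : O U) : rres O h' (rres O h a) = rres O h'' a.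
Proof. by case: (rres_sheaf O) => _ + _; apply. Qed.

Lemma msec_sep M (U : opens X) (s t : M U) :
  (forall p (hp : oset U p), mres M (minopen_sub hp) s = mres M (minopen_sub hp) t) ->
  s = t.
Proof. exact: (sheaf_sep (mres_sheaf M)). Qed.

Lemma free_resE (I : Type) (U V : opens X) (h : V `<=` U) (f : free_module (O U) I) :
  free_res h f = free_map (rres O h) f.
Proof. exact: free_ext. Qed.

Section FreeHom.
Variables (W : opens X) (I : Type) (M : omodule O) (s : I -> M W).

Definition free_hom_fun (U : opens X) (hU : U `<=` W) :
    {linear free_omodule O I U -> M U} :=
  lincomb (fun i => mres M hU (s i)).

Lemma free_hom_res (U V : opens X) (hU : U `<=` W) (hV : V `<=` W) (h : V `<=` U)
    (f : free_omodule O I U) :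
  free_hom_fun hV (mres (free_omodule O I) h f) = mres M h (free_hom_fun hU f).
Proof.
rewrite [mres _ h f]free_resE /free_hom_fun /= (semilinear_lincomb (mresZ h)).
by apply: eq_lincomb => i; rewrite (mres_comp _ _ hV).
Qed.

Definition free_hom : omod_hom W (free_omodule O I) M := OModHom free_hom_res.

Lemma free_homE (U : opens X) (hU : U `<=` W) f :
  ohom free_hom hU f = lincomb (fun i => mres M hU (s i)) f.
Proof. by []. Qed.

Lemma free_hom_basis (hW : W `<=` W) i : ohom free_hom hW (free_basis (O W) i) = s i.
Proof. by rewrite free_homE lincomb_basis mres_id. Qed.
End FreeHom.

Definition ocomp W M N T (g : omod_hom W N T) (f : omod_hom W M N) : omod_hom W M T.
Proof.
by exists (fun U hU => (ohom g hU \o ohom f hU : {linear M U -> T U})) => U V hU hV h s /=;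
  rewrite !(ohom_res _ hU hV h).
Defined.

Definition oid M : omod_hom (full X) M M.
Proof. by exists (fun U hU => idfun). Defined.

Section Kernel.
Variables (M N : omodule O) (f : omod_hom (full X) M N).

Definition oker_sec (U : opens X) : lmodType (O U) := lker (ohom f (@subsetT _ (U : set X))).

Lemma oker_res_subproof (U V : opens X) (h : V `<=` U) (s : oker_sec U) :
  ohom f (@subsetT _ (V : set X)) (mres M h (lker_val s)) = 0.
Proof. by rewrite (ohom_res f (@subsetT _ (U : set X))) lker0 raddf0. Qed.

Definition oker_res (U V : opens X) (h : V `<=` U) (s : oker_sec U) : oker_sec V :=
  mklker (oker_res_subproof h s).

Lemma oker_res_additive (U V : opens X) (h : V `<=` U) : zmod_morphism (oker_res h).
Proof. by move=> s t; apply/val_inj; exact: (raddfB (mres M h)). Qed.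
HB.instance Definition _ (U V : opens X) (h : V `<=` U) :=
  GRing.isZmodMorphism.Build _ _ (oker_res h) (oker_res_additive h).

Lemma oker_resZ (U V : opens X) (h : V `<=` U) (a : O U) (s : oker_sec U) :
  oker_res h (a *: s) = rres O h a *: oker_res h s.
Proof. by apply/val_inj; exact: mresZ. Qed.

Lemma oker_sheaf :
  is_sheaf (fun (U V : opens X) (h : V `<=` U) => oker_res h : oker_sec U -> oker_sec V).
Proof.
have [res1 resD glue] := mres_sheaf M.
split=> [U h s|U V W hUV hVW hUW s|U K V hV s UV sV].
- by apply/val_inj; exact: res1.
- by apply/val_inj; exact: resD.
have [|t [tP t_uniq]] := glue U K V hV (fun k => lker_val (s k)) UV.
  move=> i j W hi hj; exact: (congr1 (@lker_val _ _ _ _) (sV i j W hi hj)).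
have t0 : ohom f (@subsetT _ (U : set X)) t = 0.
  apply: msec_sep => p hp.
  have [k hk] : exists k, oset (V k) p by move: (hp); rewrite UV => -[k _ hk]; exists k.
  rewrite -(ohom_res f _ (@subsetT _ (minopen p : set X))) raddf0.
  rewrite -(mres_comp (hV k) (minopen_sub hk)) tP.
  by rewrite (ohom_res f (@subsetT _ (V k : set X))) lker0 raddf0.
exists (mklker t0); split=> [k|u uP]; apply/val_inj; first exact: tP.
by apply: t_uniq => k; exact: (congr1 (@lker_val _ _ _ _) (uP k)).
Qed.

Definition okernel : omodule O :=
  @OModule X O oker_sec (fun U V h => oker_res h) oker_resZ oker_sheaf.

Definition oker_incl : omod_hom (full X) okernel M.
Proof.
by exists (fun U hU => (@lker_val _ _ _ _ : {linear okernel U -> M U})).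
Defined.
End Kernel.
End OModules.

(** * Descent along stalkwise surjections, and cokernels *)

Section MoreOModules.
Variables (X : finTopologicalType) (O : ringsheaf X).
Implicit Types M N T : omodule O.

Definition stalkwise_surj M N (f : omod_hom (full X) M N) : Prop :=
  forall p (m : N (minopen p)), exists s, ohom f (@minopen_full X p) s = m.

Section Descent.
Variables (N0 M T : omodule O) (f : omod_hom (full X) N0 M) (g : omod_hom (full X) N0 T).
Hypotheses (f_surj : stalkwise_surj f)
  (fg : forall p s, ohom f (@minopen_full X p) s = 0 -> ohom g (@minopen_full X p) s = 0).

(** The image of [m] is characterized through all stalkwise lifts [n], so that uniqueness and
    linearity involve no chosen lift. *)
Definition is_desc (U : opens X) (m : M U) (t : T U) : Prop :=
  forall p (hp : oset U p) n, ohom f (@minopen_full X p) n = mres M (minopen_sub hp) m ->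
    mres T (minopen_sub hp) t = ohom g (@minopen_full X p) n.

Lemma desc_fun p n n' : ohom f (@minopen_full X p) n = ohom f (@minopen_full X p) n' ->
  ohom g (@minopen_full X p) n = ohom g (@minopen_full X p) n'.
Proof.
move=> e; apply/eqP; rewrite -subr_eq0 -raddfB; apply/eqP/fg.
by rewrite raddfB; apply/eqP; rewrite subr_eq0; apply/eqP.
Qed.

(** Lifts along [f] exist only on stalks and are not compatible. Their images under [g] are, since
    two lifts differ by an element killed by [f], hence by [g]. *)
Lemma desc_exists (U : opens X) (m : M U) : exists t, is_desc m t.
Proof.
have ex (i : {p | oset U p}) : exists n,
    ohom f (@minopen_full X (sval i)) n = mres M (minopen_sub (svalP i)) m.
  exact: f_surj.
have [n nP] := dep_choice ex.
pose s p (hp : oset U p) := ohom g (@minopen_full X p) (n (exist _ p hp)).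
have sP p (hp : oset U p) n' : ohom f (@minopen_full X p) n' = mres M (minopen_sub hp) m ->
    s p hp = ohom g (@minopen_full X p) n'.
  move=> n'P; apply: desc_fun; rewrite n'P (nP (exist _ p hp)) /=.
  by congr (mres M _ m); exact: Prop_irrelevance.
have [|t tP] := sheaf_glue (mres_sheaf T) (U := U) (s := s).
  move=> p q hp hq h; rewrite (sP q hq (mres N0 h (n (exist _ p hp)))).
    by rewrite (ohom_res g (@minopen_full X p)).
  rewrite (ohom_res f (@minopen_full X p)) (nP (exist _ p hp)) /=.
  exact: mres_comp.
by exists t => p hp n' n'P; rewrite tP; exact: sP.
Qed.

Lemma desc_unique (U : opens X) (m : M U) t t' : is_desc m t -> is_desc m t' -> t = t'.
Proof.
move=> tP t'P; apply: msec_sep => p hp.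
have [n nP] := f_surj (mres M (minopen_sub hp) m).
by rewrite (tP p hp n nP) (t'P p hp n nP).
Qed.

Lemma is_descP (U : opens X) a (m m' : M U) t t' :
  is_desc m t -> is_desc m' t' -> is_desc (a *: m + m') (a *: t + t').
Proof.
move=> tP t'P p hp n nP.
have [n1 n1P] := f_surj (mres M (minopen_sub hp) m).
have [n2 n2P] := f_surj (mres M (minopen_sub hp) m').
rewrite raddfD mresZ (tP p hp n1 n1P) (t'P p hp n2 n2P) -linearP.
by apply: desc_fun; rewrite nP linearP n1P n2P raddfD mresZ.
Qed.

Lemma omodule_desc : exists h : omod_hom (full X) M T,
  forall (U : opens X) (hU : U `<=` full X) s, ohom h hU (ohom f hU s) = ohom g hU s.
Proof.
have ex (U : opens X) : exists h : M U -> T U, forall m, is_desc m (h m).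
  by have [h hP] := choice (fun m => @desc_exists U m); exists h.
have [h hP] := dep_choice ex.
have h_linear U : linear (h U).
  by move=> a m m'; apply: (desc_unique (hP U _)); exact: is_descP.
pose hl U := HB.pack_for {linear M U -> T U} (h U)
  (GRing.isLinear.Build _ _ _ _ (h U) (h_linear U)).
have h_res (U V : opens X) (hU : U `<=` full X) (hV : V `<=` full X)
      (hUV : V `<=` U) (s : M U) : hl V (mres M hUV s) = mres T hUV (hl U s).
  apply: (desc_unique (hP V _)) => p hp n nP.
  rewrite (mres_comp _ _ (minopen_sub (hUV _ hp))); apply: hP.
  by rewrite nP; exact: mres_comp.
exists (@OModHom X O (full X) M T (fun U _ => hl U) h_res) => U hU s /=.
apply: (desc_unique (hP U _)) => p hp n nP.
rewrite -(ohom_res g hU (@minopen_full X p)); apply: desc_fun.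
by rewrite nP (ohom_res f hU).
Qed.
End Descent.

Section Cokernel.
Variables (M N : omodule O) (f : omod_hom (full X) M N).

Let st (p : X) : lmodType (O (minopen p)) := lcoker (ohom f (@minopen_full X p)).

Lemma ocoker_map_subproof p q (h : spec p q) s :
  (lcoker_class (ohom f (@minopen_full X q)) \o mres N h)
    (ohom f (@minopen_full X p) s) = 0.
Proof.
apply/lcoker_class_eq0; exists (mres M h s).
exact: ohom_res.
Qed.

Definition ocoker_map p q (h : spec p q) : {additive st p -> st q} :=
  coker_lift (ocoker_map_subproof h).

Lemma ocoker_mapE p q (h : spec p q) x :
  ocoker_map h (lcoker_class _ x) = lcoker_class _ (mres N h x).
Proof. exact: coker_liftE. Qed.

Lemma ocoker_id p (h : spec p p) x : ocoker_map h x = x.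
Proof. by have [y <-] := lcokerP x; rewrite ocoker_mapE mres_id. Qed.

Lemma ocoker_comp p q r (h : spec p q) (h' : spec q r) (h'' : spec p r) x :
  ocoker_map h' (ocoker_map h x) = ocoker_map h'' x.
Proof.
by have [y <-] := lcokerP x; rewrite !ocoker_mapE (mres_comp _ _ h'').
Qed.

Lemma ocoker_mapZ p q (h : spec p q) a x :
  ocoker_map h (a *: x) = rres O h a *: ocoker_map h x.
Proof.
have [y <-] := lcokerP x; rewrite -linearZ !ocoker_mapE mresZ.
exact: linearZ.
Qed.

(** The cokernel is assembled from its stalks, since the cokernels on each open set need not form a
    sheaf. *)
Definition ocoker_psh : psh X :=
  @Psh X (fun p => st p) (fun p q h => ocoker_map h) ocoker_id ocoker_comp.

Definition ocoker_sec (U : opens X) : Type := sec ocoker_psh U.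
HB.instance Definition _ U := GRing.Zmodule.on (ocoker_sec U).

Definition ocoker_scale (U : opens X) (a : O U) (s : ocoker_sec U) : ocoker_sec U.
Proof.
exists (fun p hp => rres O (minopen_sub hp) a *: (sec_fun s hp : st p)) => p q hp hq h.
rewrite [LHS]ocoker_mapZ (rres_comp _ _ (minopen_sub hq)); congr (_ *: _).
exact: (sec_compat s).
Defined.

Lemma ocoker_scaleA U a b (s : ocoker_sec U) :
  ocoker_scale a (ocoker_scale b s) = ocoker_scale (a * b) s.
Proof. by apply: sec_ext => p hp /=; rewrite scalerA rmorphM. Qed.
Lemma ocoker_scale1 U : left_id 1 (@ocoker_scale U).
Proof. by move=> s; apply: sec_ext => p hp /=; rewrite rmorph1 scale1r. Qed.
Lemma ocoker_scaleDr U : right_distributive (@ocoker_scale U) +%R.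
Proof. by move=> a s t; apply: sec_ext => p hp; exact: scalerDr. Qed.
Lemma ocoker_scaleDl U (s : ocoker_sec U) : {morph (@ocoker_scale U)^~ s : a b / a + b}.
Proof. by move=> a b; apply: sec_ext => p hp /=; rewrite rmorphD; exact: scalerDl. Qed.
HB.instance Definition _ U := GRing.Zmodule_isLmodule.Build (O U) (ocoker_sec U)
  (@ocoker_scaleA U) (@ocoker_scale1 U) (@ocoker_scaleDr U) (@ocoker_scaleDl U).

Definition ocoker_res (U V : opens X) (h : V `<=` U) :
  {additive ocoker_sec U -> ocoker_sec V} := (@sec_res X ocoker_psh U V h).

Lemma ocoker_resZ (U V : opens X) (h : V `<=` U) (a : O U) (s : ocoker_sec U) :
  ocoker_res h (a *: s) = rres O h a *: ocoker_res h s.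
Proof.
apply: sec_ext => p hp /=; rewrite (rres_comp _ _ (minopen_sub (h _ hp))).
by congr (rres O _ a *: _); exact: Prop_irrelevance.
Qed.

Definition ocokernel : omodule O :=
  @OModule X O (fun U => ocoker_sec U) (fun U V h => ocoker_res h) ocoker_resZ
    (sec_sheaf ocoker_psh).

Definition ocoker_proj_fun (U : opens X) (s : N U) : ocokernel U.
Proof.
exists (fun p hp => lcoker_class (ohom f (@minopen_full X p)) (mres N (minopen_sub hp) s)).
move=> p q hp hq h; rewrite [LHS]ocoker_mapE; congr lcoker_class.
exact: mres_comp.
Defined.

Lemma ocoker_proj_linear (U : opens X) : linear (@ocoker_proj_fun U).
Proof. by move=> a s t; apply: sec_ext => p hp /=; rewrite raddfD mresZ linearP. Qed.
HB.instance Definition _ (U : opens X) :=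
  GRing.isLinear.Build _ _ _ _ (@ocoker_proj_fun U) (@ocoker_proj_linear U).

Lemma ocoker_proj_res (U V : opens X) (h : V `<=` U) (s : N U) :
  ocoker_proj_fun (mres N h s) = mres ocokernel h (ocoker_proj_fun s).
Proof. by apply: sec_ext => p hp; congr lcoker_class; exact: mres_comp. Qed.

Definition ocoker_proj : omod_hom (full X) N ocokernel :=
  @OModHom X O (full X) N ocokernel (fun U _ => @ocoker_proj_fun U)
    (fun U V _ _ h s => ocoker_proj_res h s).

Lemma ocoker_proj_surj : stalkwise_surj ocoker_proj.
Proof.
move=> p m; have [s sP] := lcokerP (stalk_val m : st p); exists s.
by apply: stalk_val_inj; rewrite /stalk_val /= mres_id.
Qed.

Lemma ocoker_proj_eq0 p (s : N (minopen p)) :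
  ohom ocoker_proj (@minopen_full X p) s = 0 <->
  exists t, ohom f (@minopen_full X p) t = s.
Proof.
rewrite -lcoker_class_eq0; split=> [e|e].
  have := congr1 (fun u : sec ocoker_psh (minopen p) => u p (@minopen_mem _ p)) e.
  by rewrite /= mres_id.
apply: stalk_val_inj; rewrite raddf0 /stalk_val /=.
by rewrite mres_id.
Qed.
End Cokernel.
End MoreOModules.

(** * Quasi-coherent modules *)

Section QuasiCoherent.
Variables (X : finTopologicalType) (O : ringsheaf X).
Implicit Types M N T : omodule O.

Lemma free_hom_kernel_val M N (f : omod_hom (full X) M N) (W U : opens X) (hU : U `<=` W)
    (I : Type) (s : I -> okernel f W) b :
  lker_val (ohom (free_hom s) hU b) = lincomb (fun i => mres M hU (lker_val (s i))) b.
Proof.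
exact: (linear_lincomb (@lker_val _ _ _ _ : {linear okernel f U -> M U})).
Qed.

(* Both steps of a presentation of the kernel on minopen p use all sections on
   minopen p as generators; the second one requires flatness. *)
Lemma okernel_quasi_coherent (I : Type) M (psi : omod_hom (full X) (free_omodule O I) M) :
  finite_space O -> quasi_coherent M -> stalkwise_surj psi -> quasi_coherent (okernel psi).
Proof.
move=> flat qcM psi_surj p.
have [U [I' [J [phi' [psi' [Up cok]]]]]] := qcM p.
pose K := okernel psi; pose Kp := K (minopen p).
pose val : {linear Kp -> free_module (O (minopen p)) I} := @lker_val _ _ _ _.
pose L := lker (lincomb (@id Kp)).
pose psi0 : omod_hom (minopen p) (free_omodule O Kp) K := free_hom (fun k : Kp => k).
pose phi0 : omod_hom (minopen p) (free_omodule O L) (free_omodule O Kp) :=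
  free_hom (M := free_omodule O Kp) (fun l : L => lker_val l).
exists (minopen p), Kp, L, phi0, psi0; split; first exact: minopen_mem.
move=> q pq; have h : spec p q := minopen_sub pq.
have Uq : oset U q := minopen_sub Up pq.
have valE b : lker_val (ohom psi0 (minopen_sub pq) b) =
    lincomb (fun k : Kp => free_map (rres O h) (val k)) b.
  rewrite free_hom_kernel_val; apply: eq_lincomb => k.
  by rewrite [LHS]free_resE (Prop_irrelevance (minopen_sub pq) h).
have phiE c : ohom phi0 (minopen_sub pq) c =
    lincomb (fun l : L => free_map (rres O h) (lker_val l)) c.
  rewrite free_homE; apply: eq_lincomb => l.
  by rewrite [LHS]free_resE (Prop_irrelevance (minopen_sub pq) h).
split=> [k|b]; last split=> [b0|[c <-]].
- have psiE f : ohom psi (@minopen_full X q) (free_map (rres O h) f) =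
      mres M h (ohom psi (@minopen_full X p) f).
    by rewrite -free_resE; exact: ohom_res.
  have psiE' f : ohom psi' (minopen_sub Uq) (free_map (rres O h) f) =
      mres M h (ohom psi' (minopen_sub Up) f).
    by rewrite -free_resE; exact: ohom_res.
  have phiE' f : ohom phi' (minopen_sub Uq) (free_map (rres O h) f) =
      free_map (rres O h) (ohom phi' (minopen_sub Up) f).
    by rewrite -!free_resE; exact: ohom_res.
  have k0 : ohom psi (@minopen_full X q) (lker_val k) = 0.
    exact: (lker0 k).
  (* The local presentation of [M] is compared with [psi] over the stalk at [p] and its base change
     to [q]: the kernel at [q] is spanned by elements of the kernel at [p]. *)
  have [|f|s|b bP] := kernel_spanned psiE psiE' phiE' (psi_surj p) _ _ _ k0.
  + by case: (cok p Up).
  + by have [_ ex] := cok p Up; apply/ex; exists f.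
  + by have [_ ex] := cok q Uq; move/ex.
  exists b; apply: val_inj; rewrite [LHS]valE.
  exact: bP.
- have [|c cP] := flat_relations (flat p q h) (i := val) (b := b) val_inj.
    by rewrite -valE b0.
  by exists c; rewrite phiE.
- apply: val_inj; rewrite [LHS]valE phiE linear_lincomb.
  apply: lincomb0 => l.
  have := semilinear_lincomb (sigma := rres O h) (g := @free_map _ _ (rres O h) I)
    (fun a v => free_mapZ _ a v) val (lker_val l).
  move=> /esym e; apply: etrans e _.
  have -> : lincomb val (lker_val l) = val (lincomb (@id Kp) (lker_val l)).
    by rewrite linear_lincomb.
  by rewrite lker0 !raddf0.
Qed.

Lemma presented_quasi_coherent (I J : Type) M
    (phi : omod_hom (full X) (free_omodule O J) (free_omodule O I))
    (psi : omod_hom (full X) (free_omodule O I) M) :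
  is_cokernel phi psi -> quasi_coherent M.
Proof. by move=> cok p; exists (full X), I, J, phi, psi. Qed.

(** One generator and no relation. This lets Serre-affineness apply to the structure sheaf and yield
    acyclicity of [X]. *)
Lemma unit_quasi_coherent : quasi_coherent (unit_omodule O).
Proof.
pose phi : omod_hom (full X) (free_omodule O False) (free_omodule O unit) :=
  free_hom (M := free_omodule O unit) (fun f : False => False_rect _ f).
pose psi : omod_hom (full X) (free_omodule O unit) (unit_omodule O) :=
  free_hom (M := unit_omodule O) (fun=> 1 : O (full X)).
apply: (presented_quasi_coherent (phi := phi) (psi := psi)) => q Uq.
have psiE f : ohom psi (minopen_sub Uq) f = f tt.
  have -> : f = free_single tt (f tt : O (minopen q)).
    by apply: free_ext => -[]; rewrite free_singleE; case: pselect.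
  rewrite free_homE lincomb_single free_singleE; case: pselect => // _.
  by rewrite /= [unit_res _ _]rmorph1; exact: mulr1.
split=> [m|f].
  by exists (free_single tt (m : O (minopen q))); rewrite psiE free_singleE; case: pselect.
rewrite psiE; split=> [f0|[t <-]].
  by exists 0; rewrite raddf0; apply: free_ext => -[].
by have -> : t = 0; [apply: free_ext | rewrite raddf0].
Qed.

Lemma ocokernel_quasi_coherent (I J : Type)
    (phi : omod_hom (full X) (free_omodule O J) (free_omodule O I)) :
  quasi_coherent (ocokernel phi).
Proof.
apply: (presented_quasi_coherent (phi := phi) (psi := ocoker_proj phi)) => q Uq.
rewrite (Prop_irrelevance (minopen_sub Uq) (@minopen_full X q)).
by split=> [|s]; [exact: ocoker_proj_surj | exact: ocoker_proj_eq0].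
Qed.

(** * Generation by global sections *)

Definition gen_hom M : omod_hom (full X) (free_omodule O (M (full X))) M :=
  free_hom (fun s : M (full X) => s).

Lemma global_to_stalk_additive M x : zmod_morphism (@global_to_stalk X O M x).
Proof.
apply: tensor_lift_additive => [s1 s2 b|s1 b1 b2|c s1 b].
- by rewrite raddfD scalerDr.
- exact: scalerDl.
- by rewrite mresZ scalerA mulrC.
Qed.

(** Formal sums of pure tensors and elements of the free module on the global sections are traded
    for each other; the tensor product gives way to a morphism of modules, whose kernel can be
    formed. *)
Lemma globally_generatedP M : globally_generated M <-> stalkwise_surj (gen_hom M).
Proof.
split=> GG x m.
  have [t <-] := GG x m; rewrite -(tensor_reprK t).
  elim: (tensor_repr t) => [|[s a] r [f fP]].
    exists 0; rewrite raddf0; apply/esym.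
    exact: (zmod_morphism0 (@global_to_stalk_additive M x)).
  exists (free_single s (a : O (minopen x)) + f).
  rewrite raddfD -cat1s -tensor_add_class.
  rewrite [RHS](raddfD (additive_of (@global_to_stalk_additive M x))) !additive_ofE.
  congr (_ + _); last exact: fP.
  rewrite [RHS]global_to_stalk_pure.
  exact: (lincomb_single (fun s => mres M (@minopen_full X x) s)).
have [f <-] := GG x m.
pose tau := fsum (fun (s : M (full X)) a =>
  pure_tensor s (a : restr_scalars (rres O (@minopen_full X x)))).
have tauB : zmod_morphism tau.
  by apply: fsum_zmod_morphism => s a b; exact: pure_tensorDr.
have gtB : zmod_morphism (fun f => global_to_stalk (tau f)).
  by move=> g h; rewrite tauB global_to_stalk_additive.
exists (tau f).
apply: (additive_free_ext (g := additive_of gtB)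
  (g' := lincomb (fun s => mres M (@minopen_full X x) s))) => s a.
rewrite additive_ofE /= lincomb_single /tau fsum_single ?global_to_stalk_pure //.
by move=> s' b c; exact: pure_tensorDr.
Qed.
End QuasiCoherent.

(** * Cohomology of modules and lifting of global sections *)

Section Cohomology.
Variables (X : finTopologicalType) (O : ringsheaf X).
Implicit Types M N T : omodule O.

Notation psh_of_omodule M := (psh_of (ab_of_omodule M)).

Definition omod_pnat M N (f : omod_hom (full X) M N) :
    pnat (psh_of_omodule M) (psh_of_omodule N).
Proof.
exists (fun p => (ohom f (@minopen_full X p) : {additive M (minopen p) -> N (minopen p)})).
by move=> p q h x; exact: ohom_res.
Defined.

Lemma okernel_ses M N (f : omod_hom (full X) M N) : stalkwise_surj f ->
  ses (omod_pnat (oker_incl f)) (omod_pnat f).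
Proof.
move=> f_surj; split=> [p|p y|p z]; [exact: val_inj | | exact: f_surj].
split=> [y0|[x <-]]; last exact: (lker0 x).
by exists (mklker (f := ohom f (@minopen_full X p)) y0).
Qed.

(** The obstruction to lifting a global section along [f] lies in H^1 of the kernel. *)
Lemma acyclic_kernel_surj M N (f : omod_hom (full X) M N) (h : full X `<=` full X) :
  stalkwise_surj f -> acyclic (okernel f) ->
  forall n : N (full X), exists m, ohom f h m = n.
Proof.
move=> f_surj acK n.
have vK := (cohomologyS_vanishesP 0 (ab_of_omodule (okernel f))).1 (acK 0%N).
have [b cb bP] := ses_gsurj (okernel_ses f_surj) vK (compat_global (F := ab_of_omodule N) n).
have [m mP] := psh_of_global cb; exists m.
apply: (global_sep (F := ab_of_omodule N)) => p.
apply: etrans (bP p); rewrite -mP /=.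
exact/esym/ohom_res.
Qed.

Lemma free_omodule_sumlike (I : Type) :
  sumlike (psh_of_omodule (free_omodule O I)) (psh_of_omodule (unit_omodule O)).
Proof.
pose u : omodule O := unit_omodule O.
have e_additive (i : I) p : zmod_morphism (fun a : u (minopen p) =>
    free_single i (a : O (minopen p)) : free_omodule O I (minopen p)).
  by move=> a b; apply: (@addIr _ (free_single i (b : O (minopen p))));
    rewrite subrK -free_singleD subrK.
have pr_additive (i : I) p : zmod_morphism (fun f : free_omodule O I (minopen p) =>
    (f : free_module (O (minopen p)) I) i : u (minopen p)) by [].
have eE (i : I) p q (h : spec p q) (a : u (minopen p)) :
    additive_of (e_additive i q) (mres u h a) =
    mres (free_omodule O I) h (additive_of (e_additive i p) a).
  by rewrite [RHS]free_resE free_map_single.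
exists {classic I}.
exists (fun i => @PNat X (psh_of_omodule u) (psh_of_omodule (free_omodule O I))
  (fun p => additive_of (e_additive i p)) (eE i)).
exists (fun i => @PNat X (psh_of_omodule (free_omodule O I)) (psh_of_omodule u)
  (fun p => additive_of (pr_additive i p)) (fun p q h x => erefl)).
move=> p x; exists (free_supp x) => t ut st.
rewrite -[LHS](lincomb_basis_id x) /lincomb (fsumE _ ut).
- by apply: eq_bigr => i _; rewrite -free_single_basis.
- by move=> i a b; exact: scalerDl.
- by move=> i fi; apply: st; exact: mem_free_supp.
Qed.

(** * The three implications *)

Lemma quasi_affine_gen M : quasi_affine O -> quasi_coherent M -> stalkwise_surj (gen_hom M).
Proof. by move=> qa /qa /globally_generatedP. Qed.

Section Presentation.
Variable E : lmodType (O (full X)).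

Notation rel := (lker (lincomb (@id E))).

Definition pres_map : omod_hom (full X) (free_omodule O rel) (free_omodule O E) :=
  free_hom (M := free_omodule O E) (fun l : rel => lker_val l).

(** This is pi^* E, presented with all elements of [E] as generators and all relations among
    them. *)
Definition pres_module : omodule O := ocokernel pres_map.

Definition pres_proj : omod_hom (full X) (free_omodule O E) pres_module :=
  ocoker_proj pres_map.

Lemma pres_quasi_coherent : quasi_coherent pres_module.
Proof. exact: ocokernel_quasi_coherent. Qed.

Lemma pres_proj_surj : stalkwise_surj pres_proj.
Proof. exact: ocoker_proj_surj. Qed.

Lemma pres_proj_eq0 p (s : free_omodule O E (minopen p)) :
  ohom pres_proj (@minopen_full X p) s = 0 <->
  exists t, ohom pres_map (@minopen_full X p) t = s.
Proof. exact: ocoker_proj_eq0. Qed.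

Lemma pres_map_basis (h : full X `<=` full X) (l : rel) :
  ohom pres_map h (free_basis (O (full X)) l) = lker_val l.
Proof. exact: (free_hom_basis (M := free_omodule O E)). Qed.

Lemma pres_proj_map (h : full X `<=` full X) t :
  ohom pres_proj h (ohom pres_map h t) = 0.
Proof.
apply: (msec_sep (M := pres_module)) => p hp.
rewrite -(ohom_res pres_proj h (@minopen_full X p)) raddf0.
rewrite -(ohom_res pres_map h (@minopen_full X p)).
by apply/pres_proj_eq0; eexists.
Qed.

Lemma pres_proj_rel (h : full X `<=` full X) (f : free_module (O (full X)) E) :
  lincomb (@id E) f = 0 -> ohom pres_proj h f = 0.
Proof.
move=> f0; have := pres_proj_map h (free_basis (O (full X)) (mklker f0)).
by rewrite pres_map_basis.
Qed.
End Presentation.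

Lemma affine_quasi_affine : sections_equivalence O -> quasi_affine O.
Proof.
move=> [faithful fullness _] M qcM; apply/globally_generatedP.
pose E := M (full X); have h := @subset_refl _ (full X : set X).
have gen_pres (W : opens X) (hW : W `<=` full X) t :
    ohom (gen_hom M) hW (ohom (pres_map E) hW t) = 0.
  rewrite free_homE (linear_lincomb (ohom (gen_hom M) hW)); apply: lincomb0 => l.
  rewrite (ohom_res _ h) free_homE (eq_lincomb (t := @id E)) => [|m]; last exact: mres_id.
  by rewrite lker0 raddf0.
(* [c] is the counit pi^* pi_* M -> M. *)
have [|c cP] := omodule_desc (@pres_proj_surj E) (g := gen_hom M).
  by move=> p s /pres_proj_eq0[t <-]; exact: gen_pres.
(* The unit of the adjunction; fullness turns it into a section of c. *)
pose u (m : E) : pres_module E (full X) := ohom (pres_proj E) h (free_basis (O (full X)) m).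
have u_linear : linear u.
  move=> a m m'; apply/eqP; rewrite -subr_eq0 -linearP -raddfB; apply/eqP/pres_proj_rel.
  by rewrite linearB linearP /= !lincomb_basis subrr.
pose U := HB.pack_for {linear E -> pres_module E (full X)} u
  (GRing.isLinear.Build _ _ _ _ u u_linear).
have [g gP] := fullness M _ qcM (@pres_quasi_coherent E) U.
have cg : global_hom (ocomp c g) =1 global_hom (oid M).
  move=> m; rewrite -[LHS]/(ohom c (@subset_refl _ _) (global_hom g m)) gP.
  rewrite cP free_homE lincomb_basis; exact: mres_id.
(* Faithfulness extends [c] after [g] being the identity from global sections to all opens; and
   [gen_hom M] is [c] after the surjection [pres_proj E]. *)
have cgE := faithful M M qcM qcM _ _ cg.
move=> p m.
have [f fP] := pres_proj_surj (ohom g (@minopen_full X p) m).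
exists f; rewrite -cP fP.
exact: (cgE (minopen p) (@minopen_full X p) m).
Qed.

(** [k] bounds the distance from [n] to the range beyond the size of [X], where everything vanishes.
    H^(n+1)(M) sits between H^(n+1) of a free module and H^(n+2) of the kernel; [M] stays general
    because the step passes to that kernel. *)
Lemma hvanish_quasi_coherent :
  finite_space O -> acyclic_space O -> quasi_affine O ->
  forall k n M, (#|X| < n + k)%N -> quasi_coherent M -> hvanish n (psh_of_omodule M).
Proof.
move=> flat acO qa; elim=> [|k IHk] n M; first by rewrite addn0 => ? _; exact: hvanish_dim.
rewrite addnS -addSn => nk qcM.
have gen := quasi_affine_gen qa qcM.
have S : exses (psh_of_omodule (okernel (gen_hom M)))
    (psh_of_omodule (free_omodule O (M (full X)))) (psh_of_omodule M).
  by do 2!eexists; exact: okernel_ses gen.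
apply: (hvanish_quo S); last by apply: IHk => //; exact: okernel_quasi_coherent.
apply: hvanish_sumlike; first exact: free_omodule_sumlike.
exact/cohomologyS_vanishesP/acO.
Qed.

Lemma acyclic_quasi_affine_serre :
  finite_space O -> acyclic_space O -> quasi_affine O -> serre_affine O.
Proof.
move=> flat acO qa M qcM n; apply/cohomologyS_vanishesP.
apply: (hvanish_quasi_coherent flat acO qa (k := #|X|.+1)) => //.
by rewrite addnS ltnS leq_addl.
Qed.

Section Equivalence.
Hypotheses (flat : finite_space O) (qa : quasi_affine O) (sa : serre_affine O).

(** Every stalk of [M] is spanned by restrictions of global sections, where [f] and [g] agree. *)
Lemma gen_faithful M N (f g : omod_hom (full X) M N) : quasi_coherent M ->
  global_hom f =1 global_hom g ->
  forall (U : opens X) (h : U `<=` full X), ohom f h =1 ohom g h.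
Proof.
move=> qcM fg U h m; apply: msec_sep => p hp.
rewrite -!(ohom_res _ h (@minopen_full X p)).
have [b <-] := quasi_affine_gen qa qcM (mres M (minopen_sub hp) m).
rewrite free_homE !linear_lincomb; apply: eq_lincomb => s.
rewrite !(ohom_res _ (@subset_refl _ (full X : set X))); congr (mres N _ _).
exact: fg.
Qed.

(** [u] prescribes the images of the generators. The kernel [K] is quasi-coherent, hence generated
    by its global sections; these are linear relations between global sections of [M], and [u]
    respects them. *)
Lemma gen_full M N (u : {linear M (full X) -> N (full X)}) : quasi_coherent M ->
  exists f : omod_hom (full X) M N, global_hom f =1 u.
Proof.
move=> qcM; have gen := quasi_affine_gen qa qcM.
pose psi : omod_hom (full X) (free_omodule O (M (full X))) N := free_hom u.
pose K := okernel (gen_hom M).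
have qcK : quasi_coherent K := okernel_quasi_coherent flat qcM gen.
have [|f fP] := omodule_desc gen (g := psi).
  move=> p s s0.
  pose k : K (minopen p) := mklker (f := ohom (gen_hom M) (@minopen_full X p)) s0.
  have [b bP] := quasi_affine_gen qa qcK k.
  have -> : s = lker_val k by [].
  rewrite -bP free_hom_kernel_val linear_lincomb; apply: lincomb0 => l.
  rewrite (ohom_res _ (@subset_refl _ (full X : set X))) free_homE.
  rewrite (eq_lincomb (t := u)) => [|m]; last exact: mres_id.
  have := lker0 l; rewrite free_homE (eq_lincomb (t := @id _)) => [l0|m]; last exact: mres_id.
  by rewrite -(linear_lincomb u (@id _)) l0 !raddf0.
exists f => m; have := fP (full X) (@subset_refl _ _) (free_basis (O (full X)) m).
by rewrite !free_hom_basis.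
Qed.

(** Two kernels are needed. Acyclicity of the kernel of [rho] makes each global section of pi^* E
    come from a formal combination of elements of [E]; acyclicity of the kernel of [phiK] shows that
    the combinations mapping to zero are exactly the relations of [E]. *)
Lemma gen_essentially_surjective (E : lmodType (O (full X))) :
  exists2 M : omodule O, quasi_coherent M &
    exists u : {linear M (full X) -> E}, bijective u.
Proof.
exists (pres_module E); first exact: pres_quasi_coherent.
pose A := O (full X); pose L := lker (lincomb (@id E)); pose rho := pres_proj E.
have h := @subset_refl _ (full X : set X).
pose K := okernel rho.
have qcK : quasi_coherent K.
  exact: okernel_quasi_coherent flat (@pres_quasi_coherent E) (@pres_proj_surj E).
have relK (l : L) : ohom rho (@subsetT _ (full X : set X)) (lker_val l) = 0.
  by apply: pres_proj_rel; exact: lker0.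
(* [pres_map E] with target cut down to [K], so that it becomes a stalkwise surjection onto a
   quasi-coherent module. *)
pose phiK : omod_hom (full X) (free_omodule O L) K :=
  free_hom (M := K) (fun l : L => mklker (relK l)).
have phiKE (W : opens X) (hW : W `<=` full X) t :
    lker_val (ohom phiK hW t) = ohom (pres_map E) hW t.
  by rewrite free_hom_kernel_val.
have phiK_surj : stalkwise_surj phiK.
  move=> p k; have /pres_proj_eq0[t tP] := lker0 k.
  by exists t; apply: val_inj; rewrite [LHS]phiKE.
have rho_surj := acyclic_kernel_surj h (@pres_proj_surj E) (sa qcK).
have phiK_gsurj := acyclic_kernel_surj h phiK_surj
  (sa (okernel_quasi_coherent flat qcK phiK_surj)).
have rho0 (f : free_module A E) : ohom rho h f = 0 -> lincomb (@id E) f = 0.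
  move=> f0.
  have [t tP] := phiK_gsurj (mklker (f := ohom rho (@subsetT _ (full X : set X))) f0).
  have -> : f = ohom (pres_map E) h t by rewrite -phiKE tP.
  rewrite free_homE (linear_lincomb (lincomb (@id E))); apply: lincomb0 => l.
  by rewrite (mres_id (M := free_omodule O E)); exact: lker0.
have [r rP] := choice rho_surj.
(* A chosen lift is evaluated in [E]; by [rho0] the choice is immaterial. *)
pose u (m : pres_module E (full X)) : E := lincomb (@id E) (r m : free_module A E).
have uP (f : free_module A E) : u (ohom rho h f) = lincomb (@id E) f.
  apply/eqP; rewrite -subr_eq0 -raddfB; apply/eqP/rho0.
  by rewrite raddfB /= rP subrr.
have u_linear : linear u.
  move=> a m m'; rewrite -[m]rP -[m']rP -linearP !uP.
  exact: linearP.
pose U := HB.pack_for {linear pres_module E (full X) -> E} u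
  (GRing.isLinear.Build _ _ _ _ u u_linear).
exists U; exists (fun e => ohom rho h (free_basis A e)) => [m|e]; last first.
  by rewrite [LHS]uP lincomb_basis.
rewrite -[RHS]rP; apply/eqP; rewrite -subr_eq0 -raddfB; apply/eqP/pres_proj_rel.
by rewrite linearB /= lincomb_basis subrr.
Qed.

Lemma serre_quasi_affine_affine : affine O.
Proof.
split; first exact/sa/unit_quasi_coherent.
split=> [M N qcM _ f g fg|M N qcM _ u|E].
- exact: gen_faithful.
- exact: gen_full.
- exact: gen_essentially_surjective.
Qed.
End Equivalence.
End Cohomology.

Theorem theorem3p13 (X : finTopologicalType) (O : ringsheaf X)
    (hX : finite_space O) :
  [<-> affine O;
       acyclic_space O /\ quasi_affine O;
       quasi_affine O /\ serre_affine O].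
Proof.
tfae.
- by move=> [acO eqv]; split=> //; exact: affine_quasi_affine.
- by move=> [acO qa]; split=> //; exact: acyclic_quasi_affine_serre.
- by move=> [qa sa]; exact: serre_quasi_affine_affine.
Qed.
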